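(* Let $\zeta=e^{\pi\mathrm i/6}$, $h=\zeta^2=e^{\pi\mathrm i/3}$, and $R=\frac{\mathrm i\zeta}{2}(I_{16}+U+V+UV)\in\mathrm{End}(W\otimes W)$. The operator $R$ lies in the class $[e^{\pi\mathrm i/3},1/2,4]$, and this class is non-Temperley--Lieb, i.e. the Hecke representations determined by $R$ do not all factor through the Temperley--Lieb quotients. The local copies of $R$ give a strict localization of the tower $(H_n(3,6))_n$.
   Context: Let $K=\mathbb C^2$ with orthonormal basis $e_j$, $j\in\mathbb Z/2\mathbb Z$, $Xe_j=e_{j+1}$, $Ze_j=(-1)^je_j$, $W=K\otimes K$. On $W\otimes W=(K\otimes K)\otimes(K\otimes K)$ put $U=\mathrm i\,(I\otimes Z)\otimes(Z\otimes I)$ and $V=\mathrm i\,(X\otimes I)\otimes(X\otimes X)$. $R$ is a unitary Yang--Baxter operator; $R_i=I^{\otimes(i-1)}\otimes R\otimes I^{\otimes(n-i-1)}$ are its local copies on $W^{\otimes n}$. For a unitary Yang--Baxter operator $S$ on a $d$-dimensional Hilbert space $D$ with $\mathrm{Spec}(S)=\{-1,q\}$, $q\ne\pm1$, put $p_S=\frac{qI-S}{1+q}$ and $\eta(S)=\mathrm{rank}(p_S)/d^2$. Two such operators are equivalent (in Lechner's sense) if their associated representations of every braid group are unitarily equivalent, and $[q,\eta,d]$ denotes the (possibly empty) equivalence class with Hecke parameter $q$, spectral density $\eta$ and local dimension $d$. $H_n(q)$ is the Hecke algebra with generators $g_1,\dots,g_{n-1}$, braid relations and $(g_i+1)(g_i-q)=0$;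 $S$ determines Hecke representations $H_n(q)\to\mathrm{End}(D^{\otimes n})$, $g_i\mapsto S_i$. The Temperley--Lieb quotient of $H_n(q)$ is by the relations $e_ie_je_i=\frac q{(1+q)^2}e_i$, $|i-j|=1$, $e_i=\frac{q-g_i}{q+1}$. $H_n(3,6)$ is the semisimple Hecke braid-image algebra on $n$ strands associated with $SU(3)_3$: the quotient of $H_n(h)$, $h=e^{2\pi\mathrm i/6}$, by the radical $\{x:\mathrm{tr}(xy)=0\ \forall y\}$ of the Markov (Ocneanu) trace with $\mathrm{tr}(1)=1$, $\mathrm{tr}(xy)=\mathrm{tr}(yx)$, $\mathrm{tr}(xe_m)=\frac12\mathrm{tr}(x)$ for $x\in H_m(h)\subset H_{m+1}(h)$, $e_m=\frac{h-g_m}{h+1}$. A Yang--Baxter operator $R$ on $W$ is a strict localization of a compatible tower of braid-image algebras $(\mathcal D_n)$ if its local copies on tensor powers of the one fixed space $W$ induce a faithful representation of $\mathcal D_n$ for every $n$ (here $g_i\mapsto R_i$). *)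

(* Defs.v *)
From HB Require Import structures.
From mathcomp Require Import all_boot all_order all_algebra.
From mathcomp Require Import generic_quotient finmap.
From mathcomp.multinomials Require Import monalg.
From mathcomp Require Import mxtens complex boolp reals trigo.

Set Implicit Arguments.
Unset Strict Implicit.
Unset Printing Implicit Defensive.

Import Order.TTheory GRing.Theory Num.Theory.
Local Open Scope ring_scope.
Local Open Scope quotient_scope.

Notation "A *t B" := (tensmx A B)
  (at level 40, left associativity, format "A  *t  B").

(* Unital associative algebras over a field, as rings with a central
   structure morphism.  The zero ring is allowed: MathComp's algType requires
   1 != 0, which is not known a priori for an algebra given by generators and
   relations, and fails for 0 x 0 matrices. *)

HB.mixin Record hasScalars (K : fieldType) A of GRing.PzRing A := {
  scal : K -> A;
  scal1 : scal 1 = 1;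
  scalD : {morph scal : a b / a + b};
  scalM : {morph scal : a b / a * b};
  scalC : forall (k : K) (x : A), scal k * x = x * scal k
}.

#[short(type="pzAlgType")]
HB.structure Definition PzAlgebra (K : fieldType) :=
  {A of GRing.PzRing A & hasScalars K A}.

Arguments scal {K s} k.

Definition alg_hom (K : fieldType) (A B : pzAlgType K) (f : A -> B) : Prop :=
  [/\ {morph f : x y / x + y}, {morph f : x y / x * y} &
      forall k : K, f (scal k) = scal k].

Lemma scal0 (K : fieldType) (A : pzAlgType K) : scal 0 = 0 :> A.
Proof. by apply: (addIr (scal 0)); rewrite -scalD !add0r. Qed.

Section AlgHomTheory.
Variables (K : fieldType) (A : pzAlgType K).
Variables (B : pzAlgType K) (f : A -> B) (f_hom : alg_hom f).

Lemma alg_hom0 : f 0 = 0.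
Proof. by have [_ _ fk] := f_hom; rewrite -(scal0 A) fk scal0. Qed.

Lemma alg_hom1 : f 1 = 1.
Proof. by have [_ _ fk] := f_hom; rewrite -(@scal1 K A) fk scal1. Qed.

Lemma alg_homB x y : f (x - y) = f x - f y.
Proof.
have [fD _ _] := f_hom.
by apply: (addIr (f y)); rewrite -fD !subrK.
Qed.

Lemma alg_hom_braid a b :
  f (a * b * a - b * a * b) = f a * f b * f a - f b * f a * f b.
Proof. by have [_ fM _] := f_hom; rewrite alg_homB !fM. Qed.

Lemma alg_hom_comm a b : f (a * b - b * a) = f a * f b - f b * f a.
Proof. by have [_ fM _] := f_hom; rewrite alg_homB !fM. Qed.

Lemma alg_hom_quad (q : K) a :
  f ((a + 1) * (a - scal q)) = (f a + 1) * (f a - scal q).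
Proof. by have [fD fM fk] := f_hom; rewrite fM fD alg_homB alg_hom1 fk. Qed.
End AlgHomTheory.

Section MatrixAlgebra.
Variables (K : fieldType) (n : nat).

Lemma mx_scalD : {morph (@scalar_mx K n) : a b / a + b}.
Proof. by move=> a b; rewrite raddfD. Qed.

Lemma mx_scalM : {morph (@scalar_mx K n) : a b / a * b}.
Proof. by move=> a b; rewrite scalar_mxM. Qed.

Lemma mx_scalC (k : K) (x : 'M[K]_n) : k%:M * x = x * k%:M.
Proof. by rewrite -[LHS]/(k%:M *m x) -scalar_mxC. Qed.

HB.instance Definition _ :=
  hasScalars.Build K 'M[K]_n erefl mx_scalD mx_scalM mx_scalC.
End MatrixAlgebra.

Section MonoidAlgebra.
Variables (K : monomType) (C : fieldType).

Lemma malg_scalC (c : C) (x : {malg C[K]}) : c%:MP * x = x * c%:MP.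
Proof.
apply/malgP => k; rewrite mcoeffCM mcoeffMl.
under eq_bigr => i _.
  rewrite (big_fset_incl _ (@msuppC_le K C c)) /=; last first.
    by move=> j _ /mcoeff_outdom ->; rewrite mulr0 mul0rn.
  rewrite big_seq_fset1 mulm1 mcoeffC eqxx mulr1n.
over.
have [kx|kx] := msuppP x k.
  rewrite (big_fsetD1 k) //= eqxx mulr1n big1_fset ?addr0 1?mulrC //.
  by move=> i; rewrite in_fsetD1 => /andP[/negPf->].
rewrite mulr0 big1_fset // => i ix _; case: eqP => // ik.
by rewrite -ik ix in kx.
Qed.

HB.instance Definition _ := hasScalars.Build C {malg C[K]}
  (@mpolyC1E K C) (@monalgUD K C mone) (@mpolyCM K C) malg_scalC.
End MonoidAlgebra.

Notation free_alg C X := {malg C[{fmonom X}]}.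

Definition fgen (C : fieldType) (X : choiceType) (i : X) : free_alg C X :=
  << fmu i >>.

Section FreeEval.
Variables (C : fieldType) (X : choiceType) (B : pzAlgType C) (f : X -> B).

Definition free_eval (x : free_alg C X) : B :=
  \sum_(w <- msupp x) scal x@_w * \prod_(i <- (w : seq X)) f i.

Lemma free_evalEw (d : {fset {fmonom X}}) x : (msupp x `<=` d)%fset ->
  free_eval x = \sum_(w <- d) scal x@_w * \prod_(i <- (w : seq X)) f i.
Proof.
move=> le; rewrite /free_eval (big_fset_incl _ le) => //= w wd.
by move/mcoeff_outdom=> ->; rewrite scal0 mul0r.
Qed.

Lemma free_evalU c (w : {fmonom X}) :
  free_eval << c *g w >> = scal c * \prod_(i <- (w : seq X)) f i.
Proof. by rewrite (free_evalEw msuppU_le) big_seq_fset1 mcoeffUU. Qed.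

Lemma free_eval_gen i : free_eval (fgen C i) = f i.
Proof. by rewrite free_evalU scal1 mul1r fmuE /= big_seq1. Qed.

Lemma free_evalD : {morph free_eval : x y / x + y}.
Proof.
move=> x y; pose E := (msupp (x + y)%R `|` (msupp x `|` msupp y))%fset.
have sE z : z \in [:: x + y; x; y] -> (msupp z `<=` E)%fset.
  rewrite !inE /E => /or3P[] /eqP->; apply/fsubsetP => w wz;
  by rewrite !inE wz ?orbT.
rewrite !(free_evalEw (d := E)) ?sE ?inE ?eqxx ?orbT //.
rewrite -big_split /=; apply: eq_bigr => w _.
by rewrite mcoeffD scalD mulrDl.
Qed.

Lemma free_evalM : {morph free_eval : x y / x * y}.
Proof.
have fev0 : free_eval 0 = 0 by rewrite /free_eval msupp0 big_seq_fset0.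
move=> x y; rewrite malgME (big_morph _ free_evalD fev0) {2}/free_eval mulr_suml.
apply: eq_bigr => k _; rewrite (big_morph _ free_evalD fev0) {2}/free_eval.
rewrite mulr_sumr; apply: eq_bigr => l _; rewrite free_evalU scalM.
rewrite -!mulrA; congr (_ * _); rewrite [in RHS]mulrA -scalC -mulrA.
by congr (_ * _); rewrite /mmul /mul /= fmmulE big_cat.
Qed.

Lemma free_eval_hom : alg_hom free_eval.
Proof.
split; [exact: free_evalD | exact: free_evalM | move=> k].
by rewrite free_evalU /mone /one /= fmoneE big_nil mulr1.
Qed.
End FreeEval.

Section IdealQuotient.
Variables (K : fieldType) (A : pzAlgType K) (S : A -> Prop).

(* Closure under opposites and scalars follows, as A is unital. *)
Definition two_sided_ideal (I : A -> Prop) : Prop :=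
  [/\ I 0, forall x y, I x -> I y -> I (x + y) &
      forall a b x, I x -> I (a * x * b)].

Definition gen_ideal (x : A) : Prop :=
  forall I, two_sided_ideal I -> (forall y, S y -> I y) -> I x.

Lemma gen_ideal0 : gen_ideal 0.
Proof. by move=> I [I0 _ _]. Qed.

Lemma gen_idealD x y : gen_ideal x -> gen_ideal y -> gen_ideal (x + y).
Proof.
move=> Ix Iy I idI SI; have [_ ID _] := idI.
by apply: ID; [apply: Ix | apply: Iy].
Qed.

Lemma gen_idealM a b x : gen_ideal x -> gen_ideal (a * x * b).
Proof. by move=> Ix I idI SI; have [_ _ IM] := idI; apply: IM; apply: Ix. Qed.

Lemma gen_idealMl a x : gen_ideal x -> gen_ideal (a * x).
Proof. by move/(gen_idealM a 1); rewrite mulr1. Qed.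

Lemma gen_idealMr a x : gen_ideal x -> gen_ideal (x * a).
Proof. by move/(gen_idealM 1 a); rewrite mul1r. Qed.

Lemma gen_idealN x : gen_ideal x -> gen_ideal (- x).
Proof. by move/(gen_idealMl (- 1)); rewrite mulN1r. Qed.

Lemma gen_ideal_sub x : S x -> gen_ideal x.
Proof. by move=> Sx I _; apply. Qed.

Definition ideal_equiv (x y : A) : bool := `[< gen_ideal (x - y) >].

Lemma ideal_equiv_refl : reflexive ideal_equiv.
Proof. by move=> x; apply/asboolP; rewrite subrr; exact: gen_ideal0. Qed.

Lemma ideal_equiv_sym : symmetric ideal_equiv.
Proof.
by move=> x y; apply/asboolP/asboolP => /gen_idealN; rewrite opprB.
Qed.

Lemma ideal_equiv_trans : transitive ideal_equiv.
Proof.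
move=> y x z /asboolP Ixy /asboolP Iyz; apply/asboolP.
by have := gen_idealD Ixy Iyz; rewrite addrA subrK.
Qed.

Canonical ideal_equiv_rel :=
  EquivRel ideal_equiv ideal_equiv_refl ideal_equiv_sym ideal_equiv_trans.

Definition ideal_quot : Type := {eq_quot ideal_equiv_rel}.
HB.instance Definition _ := Choice.on ideal_quot.

Definition qpi (x : A) : ideal_quot := \pi_ideal_quot x.

Lemma qpiP x y : qpi x = qpi y <-> gen_ideal (x - y).
Proof. by rewrite /qpi; split => [/eqmodP/asboolP|/asboolP h]; last apply/eqmodP. Qed.

Lemma qpi_repr (u : ideal_quot) : qpi (repr u) = u.
Proof. exact: reprK. Qed.

Lemma repr_qpi x : gen_ideal (repr (qpi x) - x).
Proof. by apply/qpiP; rewrite qpi_repr. Qed.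

Definition quot_zero : ideal_quot := qpi 0.
Definition quot_one : ideal_quot := qpi 1.
Definition quot_add (u v : ideal_quot) : ideal_quot := qpi (repr u + repr v).
Definition quot_opp (u : ideal_quot) : ideal_quot := qpi (- repr u).
Definition quot_mul (u v : ideal_quot) : ideal_quot := qpi (repr u * repr v).
Definition quot_scal k : ideal_quot := qpi (scal k).

Lemma qpi_add x y : quot_add (qpi x) (qpi y) = qpi (x + y).
Proof.
apply/qpiP; have := gen_idealD (repr_qpi x) (repr_qpi y).
by rewrite addrACA -opprD.
Qed.

Lemma qpi_opp x : quot_opp (qpi x) = qpi (- x).
Proof. by apply/qpiP; rewrite -opprD; exact: (gen_idealN (repr_qpi x)). Qed.

Lemma qpi_mul x y : quot_mul (qpi x) (qpi y) = qpi (x * y).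
Proof.
apply/qpiP.
have := gen_idealD (gen_idealMr (repr (qpi y)) (repr_qpi x))
                   (gen_idealMl x (repr_qpi y)).
by rewrite mulrBl mulrBr addrA subrK.
Qed.

Lemma qpi_ind (P : ideal_quot -> Prop) : (forall x, P (qpi x)) -> forall u, P u.
Proof. by move=> Px u; rewrite -[u]qpi_repr. Qed.

Lemma quot_addA : associative quot_add.
Proof.
move=> u v w; elim/qpi_ind: u => ?; elim/qpi_ind: v => ?.
by elim/qpi_ind: w => ?; rewrite !qpi_add addrA.
Qed.
Lemma quot_addC : commutative quot_add.
Proof. by move=> u v; elim/qpi_ind: u => ?; elim/qpi_ind: v => ?; rewrite !qpi_add addrC. Qed.
Lemma quot_add0 : left_id quot_zero quot_add.
Proof. by move=> u; elim/qpi_ind: u => ?; rewrite qpi_add add0r. Qed.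
Lemma quot_addN : left_inverse quot_zero quot_opp quot_add.
Proof. by move=> u; elim/qpi_ind: u => ?; rewrite qpi_opp qpi_add addNr. Qed.

HB.instance Definition _ :=
  GRing.isZmodule.Build ideal_quot quot_addA quot_addC quot_add0 quot_addN.

Lemma quot_mulA : associative quot_mul.
Proof.
move=> u v w; elim/qpi_ind: u => ?; elim/qpi_ind: v => ?.
by elim/qpi_ind: w => ?; rewrite !qpi_mul mulrA.
Qed.
Lemma quot_mul1 : left_id quot_one quot_mul.
Proof. by move=> u; elim/qpi_ind: u => ?; rewrite qpi_mul mul1r. Qed.
Lemma quot_mulr1 : right_id quot_one quot_mul.
Proof. by move=> u; elim/qpi_ind: u => ?; rewrite qpi_mul mulr1. Qed.
Lemma quot_mulDl : left_distributive quot_mul quot_add.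
Proof.
move=> u v w; elim/qpi_ind: u => ?; elim/qpi_ind: v => ?.
by elim/qpi_ind: w => ?; rewrite !(qpi_mul, qpi_add) mulrDl.
Qed.
Lemma quot_mulDr : right_distributive quot_mul quot_add.
Proof.
move=> u v w; elim/qpi_ind: u => ?; elim/qpi_ind: v => ?.
by elim/qpi_ind: w => ?; rewrite !(qpi_mul, qpi_add) mulrDr.
Qed.

HB.instance Definition _ :=
  GRing.Zmodule_isPzRing.Build ideal_quot quot_mulA quot_mul1 quot_mulr1
    quot_mulDl quot_mulDr.

Lemma quot_scal1 : quot_scal 1 = 1.
Proof. by rewrite /quot_scal scal1. Qed.
Lemma quot_scalD : {morph quot_scal : a b / a + b}.
Proof. by move=> a b; rewrite /quot_scal scalD -qpi_add. Qed.
Lemma quot_scalM : {morph quot_scal : a b / a * b}.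
Proof. by move=> a b; rewrite /quot_scal scalM -qpi_mul. Qed.
Lemma quot_scalC k (u : ideal_quot) : quot_scal k * u = u * quot_scal k.
Proof.
by elim/qpi_ind: u => x; rewrite /GRing.mul /= !qpi_mul scalC.
Qed.

HB.instance Definition _ :=
  hasScalars.Build K ideal_quot quot_scal1 quot_scalD quot_scalM quot_scalC.

Lemma qpi_hom : alg_hom qpi.
Proof. by split=> // x y; rewrite -?qpi_add -?qpi_mul. Qed.

Section Lift.
Variables (B : pzAlgType K) (f : A -> B).

Definition quot_lift (u : ideal_quot) : B := f (repr u).

Hypotheses (f_hom : alg_hom f) (fS : forall x, S x -> f x = 0).

Lemma quot_lift_pi x : quot_lift (qpi x) = f x.
Proof.
have [fD fM _] := f_hom; have f0 := alg_hom0 f_hom.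
have : f (repr (qpi x) - x) = 0.
  apply: (repr_qpi x (I := fun z => f z = 0)); last exact: fS.
  split=> // [u v fu fv|a b u fu]; first by rewrite fD fu fv addr0.
  by rewrite !fM fu mulr0 mul0r.
by move=> fz; rewrite /quot_lift -[repr _](subrK x) fD fz add0r.
Qed.

Lemma quot_lift_hom : alg_hom quot_lift.
Proof.
have [fD fM fk] := f_hom; have [pD pM pk] := qpi_hom.
split.
- move=> u v; elim/qpi_ind: u => x; elim/qpi_ind: v => y.
  by rewrite -pD !quot_lift_pi fD.
- move=> u v; elim/qpi_ind: u => x; elim/qpi_ind: v => y.
  by rewrite -pM !quot_lift_pi fM.
- by move=> k; rewrite -pk quot_lift_pi fk.
Qed.
End Lift.
End IdealQuotient.

Section HeckeAlgebra.
Variables (C : fieldType) (q : C).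

(* On n strands the generator g_(i+1) is indexed by i : 'I_n.-1. *)

Inductive hecke_relator (n : nat) : free_alg C 'I_n.-1 -> Prop :=
| hecke_braid (i j : 'I_n.-1) of i.+1 = j :> nat :
    hecke_relator (fgen C i * fgen C j * fgen C i
                   - fgen C j * fgen C i * fgen C j)
| hecke_far (i j : 'I_n.-1) of (i.+1 < j)%N :
    hecke_relator (fgen C i * fgen C j - fgen C j * fgen C i)
| hecke_quad (i : 'I_n.-1) :
    hecke_relator ((fgen C i + 1) * (fgen C i - scal q)).

Definition hecke (n : nat) : pzAlgType C := ideal_quot (@hecke_relator n).

Definition hecke_gen (n : nat) (i : 'I_n.-1) : hecke n := qpi _ (fgen C i).

Definition hecke_idem (n : nat) (i : 'I_n.-1) : hecke n :=
  scal (q + 1)^-1 * (scal q - hecke_gen i).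

Definition widen_gen (n : nat) : 'I_n.-1 -> 'I_n.+1.-1 :=
  widen_ord (leq_pred n).

Section HeckeLift.
Variables (n : nat) (B : pzAlgType C) (f : 'I_n.-1 -> B).
Hypotheses
  (f_braid : forall i j : 'I_n.-1, i.+1 = j :> nat ->
     f i * f j * f i = f j * f i * f j)
  (f_far : forall i j : 'I_n.-1, (i.+1 < j)%N -> f i * f j = f j * f i)
  (f_quad : forall i, (f i + 1) * (f i - scal q) = 0).

Lemma hecke_relator_eval x : @hecke_relator n x -> free_eval f x = 0.
Proof.
have f_hom := free_eval_hom f; case=> [i j ij|i j ij|i].
- by rewrite (alg_hom_braid f_hom) !free_eval_gen f_braid ?subrr.
- by rewrite (alg_hom_comm f_hom) !free_eval_gen f_far ?subrr.
- by rewrite (alg_hom_quad f_hom) !free_eval_gen f_quad.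
Qed.

Lemma hecke_lift_hom : alg_hom (quot_lift (free_eval f) : hecke n -> B).
Proof.
by apply: quot_lift_hom; [exact: free_eval_hom | exact: hecke_relator_eval].
Qed.

Lemma hecke_lift_gen i : quot_lift (free_eval f) (hecke_gen i) = f i.
Proof.
rewrite quot_lift_pi ?free_eval_gen //; first exact: free_eval_hom.
exact: hecke_relator_eval.
Qed.
End HeckeLift.

Section HeckeRelations.
Variable n : nat.
Implicit Types i j : 'I_n.-1.

Lemma hecke_gen_relator x : @hecke_relator n x -> qpi (@hecke_relator n) x = 0.
Proof.
move=> rx; rewrite -(alg_hom0 (qpi_hom (@hecke_relator n))).
by apply/qpiP; rewrite subr0; exact: gen_ideal_sub.
Qed.

Lemma hecke_braidE i j : i.+1 = j :> nat ->
  hecke_gen i * hecke_gen j * hecke_gen i =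
  hecke_gen j * hecke_gen i * hecke_gen j.
Proof.
move=> ij; apply/eqP; rewrite -subr_eq0 -(alg_hom_braid (qpi_hom _)).
by apply/eqP/hecke_gen_relator; exact: hecke_braid.
Qed.

Lemma hecke_farE i j : (i.+1 < j)%N ->
  hecke_gen i * hecke_gen j = hecke_gen j * hecke_gen i.
Proof.
move=> ij; apply/eqP; rewrite -subr_eq0 -(alg_hom_comm (qpi_hom _)).
by apply/eqP/hecke_gen_relator; exact: hecke_far.
Qed.

Lemma hecke_quadE i : (hecke_gen i + 1) * (hecke_gen i - scal q) = 0.
Proof.
rewrite -(alg_hom_quad (qpi_hom _)).
by apply: hecke_gen_relator; exact: hecke_quad.
Qed.
End HeckeRelations.

Definition hecke_incl (n : nat) : hecke n -> hecke n.+1 :=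
  quot_lift (free_eval (fun i => hecke_gen (widen_gen i))).

Lemma hecke_incl_hom n : alg_hom (@hecke_incl n).
Proof.
apply: hecke_lift_hom => [i j ij|i j ij|i].
- exact: hecke_braidE.
- exact: hecke_farE.
- exact: hecke_quadE.
Qed.

Lemma hecke_incl_gen n (i : 'I_n.-1) :
  hecke_incl (hecke_gen i) = hecke_gen (widen_gen i).
Proof.
apply: hecke_lift_gen => [j k jk|j k jk|j].
- exact: hecke_braidE.
- exact: hecke_farE.
- exact: hecke_quadE.
Qed.

Inductive temperley_lieb_relator (n : nat) : hecke n -> Prop :=
| temperley_lieb_rel (i j : 'I_n.-1) of (i.+1 == j) || (j.+1 == i) :
    temperley_lieb_relator
      (hecke_idem i * hecke_idem j * hecke_idem i
       - scal (q / (1 + q) ^+ 2) * hecke_idem i).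

Definition temperley_lieb (n : nat) : pzAlgType C :=
  ideal_quot (@temperley_lieb_relator n).

(* A trace on the union of the tower hecke 0 -> hecke 1 -> ..., given by its
   restrictions; the last clause is tr (x e_m) = eta tr x for x in hecke m,
   m >= 1. *)
Definition is_markov_trace (eta : C) (tr : forall n, hecke n -> C) : Prop :=
  [/\ forall n (c : C) x y, tr n (scal c * x + y) = c * tr n x + tr n y,
      forall n x, tr n.+1 (hecke_incl x) = tr n x,
      forall n, tr n 1 = 1,
      forall n x y, tr n (x * y) = tr n (y * x) &
      forall m (x : hecke m.+1),
        tr m.+2 (hecke_incl x * @hecke_idem m.+2 ord_max) = eta * tr m.+1 x].

(* By Ocneanu's theorem there is exactly one such trace, so the default value is
   never used. *)
Definition markov_trace (eta : C) : forall n, hecke n -> C :=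
  if pselect (exists tr, is_markov_trace eta tr) is left ex_tr
  then projT1 (cid ex_tr) else fun _ _ => 0.

Definition markov_radical (eta : C) (n : nat) (x : hecke n) : Prop :=
  forall y : hecke n, markov_trace eta (x * y) = 0.

Definition hecke_mod_radical (eta : C) (n : nat) : pzAlgType C :=
  ideal_quot (@markov_radical eta n).

Definition hecke_mod_radical_gen (eta : C) (n : nat) (i : 'I_n.-1) :
    hecke_mod_radical eta n :=
  qpi _ (hecke_gen i).
End HeckeAlgebra.

Section YangBaxter.
Variables (C : numClosedFieldType) (d : nat).

Lemma local_copy_dim (n : nat) (i : 'I_n.-1) :
  (d ^ i * (d * d) * d ^ (n - i.+2) = d ^ n)%N.
Proof.
have lt_i2n : (i.+2 <= n)%N by case: n i => [|[|n]] [k].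
by rewrite mulnn -!expnD addn2 subnKC.
Qed.

(* Operators on the n-th tensor power of C^d are matrices of size d ^ n acting
   on column vectors. *)
Definition local_copy (S : 'M[C]_(d * d)) (n : nat) (i : 'I_n.-1) :
    'M[C]_(d ^ n) :=
  castmx (local_copy_dim i, local_copy_dim i)
    ((1%:M : 'M_(d ^ i)) *t S *t (1%:M : 'M_(d ^ (n - i.+2)))).

Definition yang_baxter (S : 'M[C]_(d * d)) : Prop :=
  let S1 := @local_copy S 3 ord0 in let S2 := @local_copy S 3 ord_max in
  S1 *m S2 *m S1 = S2 *m S1 *m S2.

Definition unitary_yang_baxter (S : 'M[C]_(d * d)) : Prop :=
  S \is unitarymx /\ yang_baxter S.

Definition hecke_type (q : C) (S : 'M[C]_(d * d)) : Prop :=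
  [/\ unitary_yang_baxter S, q != 1, q != - 1 &
      forall a, eigenvalue S a = (a == - 1) || (a == q)].

Definition spectral_proj (q : C) (S : 'M[C]_(d * d)) : 'M[C]_(d * d) :=
  (1 + q)^-1 *: (q%:M - S).

Definition spectral_density (q : C) (S : 'M[C]_(d * d)) : rat :=
  (\rank (spectral_proj q S))%:R / (d ^ 2)%:R.

(* The class [q, eta, d].  The parameters q, eta, d are invariants of the
   equivalence of Yang-Baxter operators and, for operators with spectrum
   {-1, q}, complete ones; so the class is the set of all operators with these
   parameters. *)
Definition hecke_class (q : C) (eta : rat) (S : 'M[C]_(d * d)) : Prop :=
  hecke_type q S /\ spectral_density q S = eta.

Definition hecke_rep (q : C) (S : 'M[C]_(d * d)) (n : nat)
    (rho : hecke q n -> 'M[C]_(d ^ n)) : Prop :=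
  alg_hom rho /\ forall i, rho (hecke_gen q i) = local_copy S i.

Definition factors_through_TL (q : C) (n : nat)
    (rho : hecke q n -> 'M[C]_(d ^ n)) : Prop :=
  exists2 tau : temperley_lieb q n -> 'M[C]_(d ^ n),
    alg_hom tau & forall x, rho x = tau (qpi _ x).

Definition is_temperley_lieb (q : C) (S : 'M[C]_(d * d)) : Prop :=
  forall n (rho : hecke q n -> 'M[C]_(d ^ n)),
    hecke_rep S rho -> factors_through_TL rho.

Definition strict_localization (D : nat -> pzAlgType C)
    (g : forall n, 'I_n.-1 -> D n) (S : 'M[C]_(d * d)) : Prop :=
  unitary_yang_baxter S /\
  forall n, exists rho : D n -> 'M[C]_(d ^ n),
    [/\ alg_hom rho, forall i, rho (g n i) = local_copy S i & injective rho].
End YangBaxter.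

Section Operator.
Variable R : realType.
Local Open Scope complex_scope.

Definition iC : R[i] := 0 +i* 1.

(* exp (i t) *)
Definition expi (t : R) : R[i] := cos t +i* sin t.

(* Column j is the image of e_j. *)
Definition opX : 'M[R[i]]_2 := \matrix_(k, j) ((k : 'Z_2) == j + 1)%:R.
Definition opZ : 'M[R[i]]_2 := \matrix_(k, j) ((- 1) ^+ j * (k == j)%:R).

Definition opU : 'M[R[i]]_((2 * 2) * (2 * 2)) :=
  iC *: ((1%:M *t opZ) *t (opZ *t 1%:M)).
Definition opV : 'M[R[i]]_((2 * 2) * (2 * 2)) :=
  iC *: ((opX *t 1%:M) *t (opX *t opX)).

Definition H36 (n : nat) : pzAlgType R[i] :=
  hecke_mod_radical (expi (2 * pi / 6)) (1 / 2) n.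

Definition H36_gen (n : nat) (i : 'I_n.-1) : H36 n :=
  hecke_mod_radical_gen _ _ i.
End Operator.

Arguments iC {R}.
Arguments opX {R}.
Arguments opZ {R}.
Arguments opU {R}.
Arguments opV {R}.

(* Main.v *)
(* U and V behave like quaternion units: U^2 = V^2 = -1 and VU = -UV; on
   neighbouring sites the copies of U commute, those of V commute, and a copy of
   U anticommutes with one of V.  The Yang-Baxter equation and the quadratic
   relation for R follow.  The second tensor legs of U, V and UV are traceless, so
   the normalized matrix trace pulls back to a Markov trace with parameter 1/2 on
   the Hecke tower; as H_{n+1} = H_n + H_n g_n H_n, there is only one such trace.
   R is unitary, so the image of H_n is closed under adjoints, and tr (A A* ) = 0
   forces A = 0: the radical of the Markov trace is exactly the kernel of the
   representation.  In the Temperley-Lieb quotient e_1 e_2 e_1 would have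
   normalized trace 1/3 * 1/2, whereas here it is 1/4. *)

Require Import Defs.
From HB Require Import structures.
From mathcomp Require Import all_boot all_order all_algebra.
From mathcomp Require Import generic_quotient finmap.
From mathcomp.multinomials Require Import monalg.
From mathcomp Require Import mxtens complex boolp reals trigo.
From mathcomp Require Import ring zify.

Set Implicit Arguments.
Unset Strict Implicit.
Unset Printing Implicit Defensive.

Import Order.TTheory GRing.Theory Num.Theory.
Local Open Scope ring_scope.

(** * The Hecke tower and its Markov trace *)

Lemma alg_hom_comp (C : fieldType) (A B D : pzAlgType C) (f : A -> B)
    (g : B -> D) :
  alg_hom f -> alg_hom g -> alg_hom (fun x => g (f x)).
Proof.
move=> [fD fM fk] [gD gM gk].
by split=> [x y|x y|k]; rewrite ?fD ?gD ?fM ?gM ?fk ?gk.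
Qed.

Lemma alg_homN (K : fieldType) (A B : pzAlgType K) (f : A -> B) :
  alg_hom f -> {morph f : x / - x}.
Proof.
by move=> f_hom x; rewrite -sub0r (alg_homB f_hom) (alg_hom0 f_hom) sub0r.
Qed.

Lemma scalMM (K : fieldType) (A : pzAlgType K) (k l : K) (x y : A) :
  scal k * x * (scal l * y) = scal (k * l) * (x * y).
Proof. by rewrite -mulrA (mulrA x) -scalC -mulrA mulrA -scalM. Qed.

Lemma quad_sq (C : fieldType) (B : pzAlgType C) (q : C) (a : B) :
  (a + 1) * (a - scal q) = 0 -> a * a = scal (q - 1) * a + scal q.
Proof.
have sB : scal (q - 1) = scal q - 1 :> B.
  by apply: (addIr 1); rewrite subrK -{1}(@scal1 C B) -scalD subrK.
rewrite mulrDl mul1r mulrBr -scalC => h; apply/eqP; rewrite -subr_eq0 -{}h sB.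
by rewrite mulrBl mul1r !opprD opprK !addrA.
Qed.

Lemma idem_of_quad (K : fieldType) (A : pzAlgType K) (q : K) (a : A) :
  q + 1 != 0 -> (a + 1) * (a - scal q) = 0 ->
  let e := scal (q + 1)^-1 * (scal q - a) in e * e = e.
Proof.
move=> q1 quad e; have ae : (a + 1) * e = 0.
  by rewrite /e mulrA -scalC -mulrA -opprB mulrN quad oppr0 mulr0.
have qa : scal q - a = scal (q + 1) - (a + 1).
  by rewrite scalD scal1 opprD addrACA subrr addr0.
by rewrite {1}/e qa -mulrA mulrBl ae subr0 mulrA -scalM mulVf // scal1 mul1r.
Qed.

(** * Elements of the form $A + A g A$ over a subalgebra $A$ *)

Section BimoduleSpan.
Variables (C : fieldType) (A B : pzAlgType C) (f : A -> B) (g : B).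

(** Models $H_n + H_n g_n H_n$ inside $H_{n+1}$. Scalars are absorbed into [a], as [f] will be an
    algebra map, so closure under sums gives a subspace. *)
Inductive bispan : B -> Prop :=
| bispan_base a : bispan (f a)
| bispan_gen a b : bispan (f a * g * f b)
| bispanD x y of bispan x & bispan y : bispan (x + y).

Hypothesis f_hom : alg_hom f.

Lemma bispanMl c x : bispan x -> bispan (f c * x).
Proof.
have [_ fM _] := f_hom; elim=> {x} [a|a b|x y _ IHx _ IHy].
- by rewrite -fM; constructor.
- by rewrite !mulrA -fM; constructor.
- by rewrite mulrDr; constructor.
Qed.

Lemma bispanMr c x : bispan x -> bispan (x * f c).
Proof.
have [_ fM _] := f_hom; elim=> {x} [a|a b|x y _ IHx _ IHy].
- by rewrite -fM; constructor.
- by rewrite -mulrA -fM; constructor.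
- by rewrite mulrDl; constructor.
Qed.

Lemma bispanZ c x : bispan x -> bispan (scal c * x).
Proof. by have [_ _ <-] := f_hom; exact: bispanMl. Qed.

Lemma bispan_scal c : bispan (scal c).
Proof. by have [_ _ <-] := f_hom; constructor. Qed.

Lemma bispan_g : bispan g.
Proof. by rewrite -[g]mul1r -[_ * g]mulr1 -(alg_hom1 f_hom); constructor. Qed.

Lemma bispan_gMl x : (forall a, bispan (g * f a * g)) ->
  bispan x -> bispan (g * x).
Proof.
move=> gg; elim=> {x} [a|a b|x y _ IHx _ IHy].
- by rewrite -[g]mul1r -(alg_hom1 f_hom); constructor.
- by rewrite !mulrA; apply: bispanMr.
- by rewrite mulrDr; constructor.
Qed.

End BimoduleSpan.

Lemma gen_of_idem (C : fieldType) (B : pzAlgType C) (q : C) (g : B) :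
  q + 1 != 0 ->
  g = scal q + scal (- (q + 1)) * (scal (q + 1)^-1 * (scal q - g)).
Proof.
move=> q1; have sN1 : scal (- 1) = - 1 :> B.
  by apply: (addIr (scal 1)); rewrite -scalD addNr scal0 scal1 addNr.
by rewrite mulrA -scalM mulNr divff // sN1 mulN1r opprB addrC subrK.
Qed.

(** The Markov property speaks of the idempotent. Cyclicity collects [f b * f a] on one side of [g],
    and substituting $g = q - (q+1)e$ turns the property into a value on the second kind of spanning
    element. *)
Lemma trace_gen_of_idem (C : fieldType) (A B : pzAlgType C) (f : A -> B)
    (trA : A -> C) (tr : B -> C) (q eta : C) (g : B) :
  alg_hom f -> q + 1 != 0 ->
  {morph tr : x y / x + y} -> (forall c x, tr (scal c * x) = c * tr x) ->
  (forall x y, tr (x * y) = tr (y * x)) -> (forall a, tr (f a) = trA a) ->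
  (forall a, tr (f a * (scal (q + 1)^-1 * (scal q - g))) = eta * trA a) ->
  forall a b, tr (f a * g * f b) = (q - (q + 1) * eta) * trA (b * a).
Proof.
move=> [_ fM _] q1 trD trZ trC trf tre a b.
rewrite trC mulrA -fM [g in LHS](gen_of_idem g q1) mulrDr trD mulrA -!scalC.
by rewrite -mulrA !trZ tre trf mulrBl !mulNr mulrA.
Qed.

(* g2 X g2 reduces to the span by the braid relation when X = g1, and by the
   quadratic one when X commutes with g2. *)
Lemma bispan_sandwich (C : fieldType) (A0 A1 A2 : pzAlgType C)
    (f0 : A0 -> A1) (f1 : A1 -> A2) (g1 : A1) (g2 : A2) (q : C) :
  alg_hom f0 -> alg_hom f1 ->
  (forall a, f1 (f0 a) * g2 = g2 * f1 (f0 a)) ->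
  f1 g1 * g2 * f1 g1 = g2 * f1 g1 * g2 ->
  (g2 + 1) * (g2 - scal q) = 0 ->
  forall x, bispan f0 g1 x -> bispan f1 g2 (g2 * f1 x * g2).
Proof.
move=> f0_hom f1_hom comm braid quad x.
have [f1D f1M _] := f1_hom; elim=> {x} [a|a b|x y _ IHx _ IHy].
- rewrite -comm -mulrA; apply: bispanMl => //.
  rewrite (quad_sq quad); constructor; last exact: bispan_scal.
  by apply: bispanZ => //; apply: bispan_g.
- rewrite !f1M !mulrA -comm -!mulrA comm; apply: bispanMl => //.
  by rewrite !mulrA -braid; apply: bispanMr => //; constructor.
- by rewrite f1D mulrDr mulrDl; constructor.
Qed.

Section HeckeTower.
Variables (C : fieldType) (q : C).
Local Notation hecke := (hecke q).
Local Notation gen := (hecke_gen q).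
Local Notation incl := (@hecke_incl C q _).

(** A representative in the free algebra is a linear combination of words, and each word is built by
    prepending one generator at a time. *)
Lemma hecke_ind n (P : hecke n -> Prop) :
  (forall c, P (scal c)) -> (forall x y, P x -> P y -> P (x + y)) ->
  (forall c x, P x -> P (scal c * x)) -> (forall i x, P x -> P (gen i * x)) ->
  forall x, P x.
Proof.
move=> Pk PD PZ Pg; elim/qpi_ind => x.
have [qD qM qk] := qpi_hom (@hecke_relator C q n).
have P0 : P 0 by rewrite -(scal0 (K := C)).
rewrite [x]monalgE (big_morph _ qD (alg_hom0 (qpi_hom _))).
apply: (big_ind P) => // w _.
have -> : << x@_w *g w >> = scal x@_w * << w >> :> free_alg C _.
  by rewrite malgM_def fgmulUU mul1m mulr1.
rewrite qM qk; apply: PZ.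
case: w => w; elim: w => [|i w IHw].
  by rewrite -fmoneE -[<< _ >>]/(scal 1) qk.
have -> : << FMonom (i :: w) >> = fgen C i * << FMonom w >> :> free_alg C _.
  by rewrite /fgen malgM_def fgmulUU mulr1 [in RHS]/mmul /= fmmulE fmuE.
by rewrite qM; apply: Pg.
Qed.

Lemma hecke_hom_ext n (B : pzAlgType C) (f f' : hecke n -> B) :
  alg_hom f -> alg_hom f' -> (forall i, f (gen i) = f' (gen i)) -> f =1 f'.
Proof.
move=> [fD fM fk] [fD' fM' fk'] fg; elim/hecke_ind => [c|x y|c x|i x].
- by rewrite fk fk'.
- by rewrite fD fD' => -> ->.
- by rewrite fM fM' fk fk' => ->.
- by rewrite fM fM' fg => ->.
Qed.

Lemma hecke_scalar n : (n <= 1)%N -> forall x : hecke n, exists c, x = scal c.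
Proof.
move=> n1; elim/hecke_ind => [c|_ _ [c ->] [c' ->]|c _ [c' ->]|i].
- by exists c.
- by exists (c + c'); rewrite scalD.
- by exists (c * c'); rewrite scalM.
- by case: n n1 i => [|[|n]] // _ [].
Qed.

Lemma widen_gen_case n (i : 'I_n.+1) :
  i = ord_max \/ exists j : 'I_n, i = @widen_gen n.+1 j.
Proof.
have [j ->|->] := unliftP ord_max i; last by left.
by right; exists j; apply: val_inj; rewrite /= /bump leqNgt ltn_ord.
Qed.

Lemma hecke_hom_comm n (B : pzAlgType C) (f : hecke n -> B) (b : B) :
  alg_hom f -> (forall i, f (gen i) * b = b * f (gen i)) ->
  forall x, f x * b = b * f x.
Proof.
move=> [fD fM fk] fg; elim/hecke_ind => [c|x y fx fy|c x fx|i x fx].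
- by rewrite fk scalC.
- by rewrite fD mulrDl mulrDr fx fy.
- by rewrite fM fk -mulrA fx !mulrA scalC.
- by rewrite fM -mulrA fx !mulrA fg.
Qed.

(** The indices of the generators in [a] are below [n], while the last generator on [n.+3] strands
    has index [n.+1]; so all of them are far apart. *)
Lemma hecke_incl_far n (a : hecke n.+1) :
  incl (incl a) * @hecke_gen C q n.+3 ord_max =
  @hecke_gen C q n.+3 ord_max * incl (incl a).
Proof.
apply: (@hecke_hom_comm n.+1 _ (fun a => incl (incl a))) => [|i].
  exact: alg_hom_comp (hecke_incl_hom q _) (hecke_incl_hom q _).
by rewrite !hecke_incl_gen; apply: hecke_farE; rewrite /= !ltnS.
Qed.

Lemma hecke_gen_case n (i : 'I_n.+1) :
  @hecke_gen C q n.+2 i = @hecke_gen C q n.+2 ord_max \/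
  exists a, @hecke_gen C q n.+2 i = @hecke_incl C q n.+1 a.
Proof.
have [->|[j ->]] := widen_gen_case i; first by left.
by right; exists (@hecke_gen C q n.+1 j); rewrite hecke_incl_gen.
Qed.

Local Notation last n := (@hecke_gen C q n.+2 ord_max).

(** It suffices that the span is stable under left multiplication by generators. For included ones
    this is clear; for the last one it reduces to $g a g$ lying in the span. By induction [a] has
    the span form one level below, where [bispan_sandwich] applies; at the bottom [a] is a
    scalar. *)
Lemma hecke_bispan n (x : hecke n.+2) : bispan (@hecke_incl C q n.+1) (last n) x.
Proof.
have step m : (forall a, bispan (@hecke_incl C q m.+1) (last m)
      (last m * @hecke_incl C q m.+1 a * last m)) ->
    forall x, bispan (@hecke_incl C q m.+1) (last m) x.
  have i_hom := hecke_incl_hom q m.+1; move=> gg.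
  elim/hecke_ind => [c|y z|c y|i y].
  - exact: bispan_scal.
  - exact: bispanD.
  - exact: bispanZ.
  have [->|[a ->]] := hecke_gen_case i; first exact: bispan_gMl.
  exact: bispanMl.
elim: n x => [|n IHn]; apply: step => a.
  have [c ->] := hecke_scalar (leqnn _) a.
  have i_hom := hecke_incl_hom q 1; have [_ _ ik] := i_hom.
  rewrite ik -scalC -mulrA (quad_sq (hecke_quadE q _)).
  apply: bispanZ => //; constructor; last exact: bispan_scal.
  by apply: bispanZ => //; apply: bispan_g.
apply: (bispan_sandwich (hecke_incl_hom q n.+1) (hecke_incl_hom q n.+2)) (IHn a).
- exact: hecke_incl_far.
- by rewrite hecke_incl_gen; apply: hecke_braidE.
- exact: hecke_quadE.
Qed.

(** * Uniqueness of the Markov trace *)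

Section MarkovTrace.
Variable eta : C.
Implicit Type tr : forall n, hecke n -> C.

Lemma markov_traceD tr : is_markov_trace eta tr ->
  forall n (x y : hecke n), tr n (x + y) = tr n x + tr n y.
Proof. by case=> tZ _ _ _ _ n x y; have := tZ n 1 x y; rewrite scal1 !mul1r. Qed.

Lemma markov_trace0 tr : is_markov_trace eta tr -> forall n, tr n 0 = 0.
Proof.
by move=> trM n; apply: (addIr (tr n 0)); rewrite -markov_traceD // !add0r.
Qed.

Lemma markov_traceZ tr : is_markov_trace eta tr ->
  forall n c (x : hecke n), tr n (scal c * x) = c * tr n x.
Proof.
move=> trM n c x; have [tZ _ _ _ _] := trM.
by rewrite -[X in tr n X]addr0 tZ markov_trace0 // addr0.
Qed.

Lemma markov_trace_scal tr : is_markov_trace eta tr ->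
  forall n c, tr n (scal c) = c.
Proof.
move=> trM n c; have [_ _ t1 _ _] := trM.
by rewrite -[scal c]mulr1 markov_traceZ // t1 mulr1.
Qed.

Lemma markov_trace_gen tr : q + 1 != 0 -> is_markov_trace eta tr ->
  forall n (x y : hecke n.+1), tr n.+2 (incl x * last n * incl y) =
    (q - (q + 1) * eta) * tr n.+1 (y * x).
Proof.
move=> q1 trM n x y; have [_ ti _ tC te] := trM.
apply: (trace_gen_of_idem (hecke_incl_hom q n.+1)) => //.
- exact: markov_traceD.
- exact: markov_traceZ.
Qed.

(** On each kind of spanning element the trace is determined by the trace on one strand fewer. The
    descent ends at scalars, where normalization fixes the value. *)
Lemma markov_trace_ext (tr tr' : forall n, hecke n -> C) : q + 1 != 0 ->
  is_markov_trace eta tr -> is_markov_trace eta tr' ->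
  forall n x, tr n x = tr' n x.
Proof.
move=> q1 trM trM'; have scalE n c : tr n (scal c) = tr' n (scal c).
  by rewrite !markov_trace_scal.
case=> [|n] x; first by have [c ->] := hecke_scalar (leq0n _) x.
elim: n x => [|n IHn] x; first by have [c ->] := hecke_scalar (leqnn _) x.
elim: (hecke_bispan x) => {x} [a|a b|x y _ IHx _ IHy].
- by have [_ -> _ _ _] := trM; have [_ -> _ _ _] := trM'.
- by rewrite !markov_trace_gen // IHn.
- by rewrite !markov_traceD // IHx IHy.
Qed.

(** A given trace witnesses existence, which excludes the default branch of [markov_trace];
    uniqueness then identifies the chosen trace with the given one. *)
Lemma markov_traceE tr : q + 1 != 0 -> is_markov_trace eta tr ->
  forall n (x : hecke n), markov_trace eta x = tr n x.
Proof.
move=> q1 trM; apply: (markov_trace_ext q1 _ trM).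
rewrite /markov_trace; case: pselect => [ex|nex].
  exact: (projT2 (cid ex)).
by case: nex; exists tr.
Qed.

End MarkovTrace.
End HeckeTower.

(** * Tensor products and local copies *)

Section PackedMatrix.
Local Open Scope sesquilinear_scope.
Variable C : numClosedFieldType.

(* Tensor products of matrices are associative and unital only up to a cast of
   the dimension, which packing the dimension with the matrix makes invisible. *)
Definition pkmx n (A : 'M[C]_n) : {n & 'M[C]_n} := Tagged (fun n => 'M[C]_n) A.

Definition pktens (x y : {n & 'M[C]_n}) := pkmx (tagged x *t tagged y).

Lemma pkmx_inj n : injective (@pkmx n).
Proof. by move=> A B /eqP; rewrite eq_Tagged => /eqP. Qed.

Lemma pkmx_cast m n (e e' : m = n) (A : 'M[C]_m) :
  pkmx (castmx (e, e') A) = pkmx A.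
Proof. by case: n / e e' => e'; rewrite (eq_irrelevance e' erefl) castmx_id. Qed.

Lemma pkmxP m n (A : 'M[C]_m) (B : 'M[C]_n) (e : m = n) :
  (forall i j, A i j = B (cast_ord e i) (cast_ord e j)) -> pkmx A = pkmx B.
Proof.
case: n / e B => B AB; congr pkmx; apply/matrixP => i j.
by rewrite AB !cast_ord_id.
Qed.

Lemma pkmx_mul m n (A B : 'M[C]_m) (A' B' : 'M[C]_n) :
  pkmx A = pkmx A' -> pkmx B = pkmx B' -> pkmx (A *m B) = pkmx (A' *m B').
Proof.
move=> AA' BB'; have e : m = n := congr1 (@tag _ _) AA'.
by case: n / e A' B' AA' BB' => A' B' /pkmx_inj-> /pkmx_inj->.
Qed.

Lemma pkmx_trace m n (A : 'M[C]_m) (B : 'M[C]_n) :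
  pkmx A = pkmx B -> \tr A = \tr B.
Proof. exact: (congr1 (fun x : {n & 'M[C]_n} => \tr (tagged x))). Qed.

Lemma pktensE m n (A : 'M[C]_m) (B : 'M[C]_n) :
  pktens (pkmx A) (pkmx B) = pkmx (A *t B).
Proof. by []. Qed.

Lemma pktensA : associative pktens.
Proof.
move=> [m A] [n B] [p D]; apply: (pkmxP (e := mulnA m n p)) => i j.
rewrite /= !mxE mulrA /=.
congr (A _ _ * B _ _ * D _ _); apply: val_inj => /=.
all: by [rewrite -divnMA [(p * n)%N]mulnC | rewrite modn_divl
        | rewrite modn_dvdm // dvdn_mull].
Qed.

Lemma tensmx_id m n : (1%:M : 'M[C]_m) *t (1%:M : 'M_n) = 1%:M.
Proof.
apply/matrixP => i j.
case: (mxtens_indexP i) => i0 i1; case: (mxtens_indexP j) => j0 j1.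
rewrite tensmxE !mxE (inj_eq (can_inj (@mxtens_indexK m n))) xpair_eqE.
by rewrite -natrM mulnb.
Qed.

Lemma pktens1l x : pktens (pkmx (1%:M : 'M_1)) x = x.
Proof.
case: x => n A; rewrite /pktens /= tens_scalar1mx.
exact: pkmx_cast.
Qed.

Lemma pktens1r x : pktens x (pkmx (1%:M : 'M_1)) = x.
Proof. by case: x => n A; rewrite /pktens /= tens_mx_scalar scale1r pkmx_cast. Qed.

Lemma mxtrace_tens m n (A : 'M[C]_m) (B : 'M[C]_n) :
  \tr (A *t B) = \tr A * \tr B.
Proof. by rewrite /mxtrace mulr_sum; apply: eq_bigr => i _; rewrite mxE. Qed.

Lemma scale_tensmx m n k (A : 'M[C]_m) (B : 'M[C]_n) :
  k *: (A *t B) = (k *: A) *t B.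
Proof. by apply/matrixP => i j; rewrite !mxE mulrA. Qed.

Lemma tensNmx m n (A : 'M[C]_m) (B : 'M_n) : - A *t B = - (A *t B).
Proof. by apply/matrixP => i j; rewrite !mxE mulNr. Qed.

Lemma tensmxN m n (A : 'M[C]_m) (B : 'M_n) : A *t - B = - (A *t B).
Proof. by apply/matrixP => i j; rewrite !mxE mulrN. Qed.

Lemma adjmx_tens m n (A : 'M[C]_m) (B : 'M[C]_n) :
  (A *t B)^t* = A^t* *t B^t*.
Proof. by rewrite trmx_tens map_mxT. Qed.

End PackedMatrix.

Lemma ltn_pred_ord n (i : 'I_n.-1) : (i.+2 <= n)%N.
Proof. by case: n i => [|n] []. Qed.

(** * Local copies on tensor powers: commutation, braid relation, added strands *)

Section LocalCopy.
Local Open Scope sesquilinear_scope.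
Variables (C : numClosedFieldType) (d : nat).
Implicit Types S A B : 'M[C]_(d * d).

Definition pkid k := pkmx (1%:M : 'M[C]_(d ^ k)).

Lemma pkid_add k l : pktens (pkid k) (pkid l) = pkid (k + l).
Proof. by rewrite /pkid pktensE tensmx_id expnD. Qed.

Lemma pkmx1_eq m k : m = (d ^ k)%N -> pkmx (1%:M : 'M[C]_m) = pkid k.
Proof. by move->. Qed.

Lemma pkmx_local_copy S n (i : 'I_n.-1) :
  pkmx (local_copy S i) = pktens (pktens (pkid i) (pkmx S)) (pkid (n - i.+2)).
Proof. by rewrite pkmx_cast -!pktensE. Qed.

Lemma castmx_hom m n (e : m = n) :
  alg_hom (castmx (e, e) : 'M[C]_m -> 'M[C]_n).
Proof. by case: n / e; split=> [A B|A B|k]; rewrite !castmx_id. Qed.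

Lemma tensmx1l_hom m n :
  alg_hom (fun A : 'M[C]_n => (1%:M : 'M_m) *t A : 'M_(m * n)).
Proof.
split=> [A B|A B|k].
- by apply/matrixP=> i j; rewrite !mxE mulrDr.
- by rewrite -[RHS]/(_ *m _) tensmx_mul mulmx1.
- rewrite -[scal k]/(k%:M) -[RHS]/(k%:M) -!(scalemx1 _ k) -tensmx_id.
  by apply/matrixP=> i j; rewrite !mxE mulrCA.
Qed.

Lemma tensmx1r_hom m n :
  alg_hom (fun A : 'M[C]_m => A *t (1%:M : 'M_n) : 'M_(m * n)).
Proof.
split=> [A B|A B|k].
- by apply/matrixP=> i j; rewrite !mxE mulrDl.
- by rewrite -[RHS]/(_ *m _) tensmx_mul mulmx1.
- rewrite -[scal k]/(k%:M) -[RHS]/(k%:M) -!(scalemx1 _ k) -tensmx_id.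
  by apply/matrixP=> i j; rewrite !mxE mulrA.
Qed.

Lemma local_copy_hom n (i : 'I_n.-1) :
  alg_hom (fun S : 'M[C]_(d * d) => local_copy S i).
Proof.
have H := alg_hom_comp (alg_hom_comp (tensmx1l_hom (d ^ i) (d * d))
  (tensmx1r_hom _ (d ^ (n - i.+2)))) (castmx_hom (local_copy_dim d i)).
exact: H.
Qed.

Lemma local_copy_far S n (i j : 'I_n.-1) : (i.+1 < j)%N ->
  local_copy S i *m local_copy S j = local_copy S j *m local_copy S i.
Proof.
move=> ij; have jn := ltn_pred_ord j.
(* [k] strands lie between the two copies and [l] to the right of the second. Both copies are cut
   right before strand [j]: one is [A] tensored with an identity, the other an identity tensored
   with [B]. *)
pose k := (j - i.+2)%N; pose l := (n - j.+2)%N.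
pose A := ((1%:M : 'M[C]_(d ^ i)) *t S) *t (1%:M : 'M[C]_(d ^ k)).
pose B := S *t (1%:M : 'M[C]_(d ^ l)).
have Ai : pkmx (local_copy S i) = pkmx (A *t (1%:M : 'M_(d * d * d ^ l))).
  rewrite pkmx_local_copy -!pktensE -!pktensA.
  rewrite (@pkmx1_eq (d * d * d ^ l) (2 + l)); last by rewrite expnD mulnn.
  by rewrite !pkid_add; congr (pktens _ (pktens _ (pkid _))); rewrite /k /l; lia.
have Bj : pkmx (local_copy S j) =
    pkmx ((1%:M : 'M_(d ^ i * (d * d) * d ^ k)) *t B).
  rewrite pkmx_local_copy -!pktensE -!pktensA.
  rewrite (@pkmx1_eq (d ^ i * (d * d) * d ^ k) j) //.
  by rewrite -mulnA mulnn -!expnD; congr (_ ^ _)%N; rewrite /k; lia.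
apply: pkmx_inj; rewrite (pkmx_mul Ai Bj) (pkmx_mul Bj Ai).
by rewrite !tensmx_mul !mulmx1 !mul1mx.
Qed.

(** Copies [i] and [i + 1] act within the same three strands, so the braid relation on [n] strands
    follows from the one on three. *)
Lemma local_copy_sub S n (i : 'I_n.-1) (j : 'I_2) (k : 'I_n.-1) :
  (i.+3 <= n)%N -> (k = i + j :> nat)%N ->
  pkmx (local_copy S k) = pktens (pktens (pkid i)
    (pkmx (@local_copy C d S 3 j))) (pkid (n - i.+3)).
Proof.
move=> i3n kij.
rewrite !pkmx_local_copy -!pktensA pkid_add [RHS]pktensA pkid_add -kij.
congr (pktens _ (pktens _ (pkid _))); rewrite kij.
by case: (i : nat) i3n (j : nat) (ltn_ord j) => [|i'] ? j' ?; lia.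
Qed.

Lemma local_copy_braid S n (i j : 'I_n.-1) : yang_baxter S -> i.+1 = j :> nat ->
  local_copy S i *m local_copy S j *m local_copy S i =
  local_copy S j *m local_copy S i *m local_copy S j.
Proof.
move=> yb ij; have jn : (i.+3 <= n)%N by rewrite ij ltn_pred_ord.
have Si := local_copy_sub S (j := ord0) jn (esym (addn0 i)).
have Sj := local_copy_sub S (i := i) (j := ord_max) (k := j) jn.
move: Sj; rewrite -ij addn1 => /(_ erefl) Sj.
rewrite !pktensE in Si Sj.
apply: pkmx_inj; rewrite (pkmx_mul (pkmx_mul Si Sj) Si).
rewrite (pkmx_mul (pkmx_mul Sj Si) Sj).
by rewrite !tensmx_mul !mulmx1 yb.
Qed.

Lemma adjmx_local_copy S n (i : 'I_n.-1) :
  (local_copy S i)^t* = local_copy (S^t*) i.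
Proof.
by rewrite /local_copy trmx_cast map_castmx !trmx_tens !map_mxT !trmx1 !map_mx1.
Qed.

Lemma expn_add_strand n : (d ^ n * d = d ^ n.+1)%N.
Proof. by rewrite expnSr. Qed.

Definition add_strand n (A : 'M[C]_(d ^ n)) : 'M[C]_(d ^ n.+1) :=
  castmx (expn_add_strand n, expn_add_strand n) (A *t (1%:M : 'M_d)).

Lemma add_strand_hom n : alg_hom (@add_strand n).
Proof.
exact: alg_hom_comp (tensmx1r_hom _ d) (castmx_hom (expn_add_strand n)).
Qed.

Lemma pkmx_add_strand n (A : 'M[C]_(d ^ n)) :
  pkmx (add_strand A) = pktens (pkmx A) (pkmx (1%:M : 'M_d)).
Proof. exact: pkmx_cast. Qed.

Lemma add_strand_local_copy S n (i : 'I_n.-1) :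
  add_strand (local_copy S i) = local_copy S (widen_gen i).
Proof.
apply: pkmx_inj; rewrite pkmx_add_strand !pkmx_local_copy -!pktensA.
rewrite (@pkmx1_eq d 1) ?expn1 // pkid_add /=.
congr (pktens _ (pktens _ (pkid _))).
by case: n i => [|[|n]] [] //= k kn; rewrite !subSS addn1 subSn.
Qed.

Lemma mxtrace_add_strand n (A : 'M[C]_(d ^ n)) :
  \tr (add_strand A) = \tr A * d%:R.
Proof.
by rewrite (pkmx_trace (pkmx_add_strand A)) mxtrace_tens mxtrace_scalar.
Qed.

(* The last local copy of P *t Q acts on the added strand by Q. *)
Lemma mxtrace_add_strand_local_copy (P Q : 'M[C]_d) m (A : 'M[C]_(d ^ m.+1)) :
  \tr Q = 0 -> \tr (add_strand A *m @local_copy C d (P *t Q) m.+2 ord_max) = 0.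
Proof.
move=> Q0.
have [B AB] : exists B : 'M_(d ^ m * d), pkmx A = pkmx B.
  exists (castmx (esym (expn_add_strand m), esym (expn_add_strand m)) A).
  by rewrite pkmx_cast.
have LE : pkmx (@local_copy C d (P *t Q) m.+2 ord_max) =
    pkmx ((1%:M : 'M_(d ^ m)) *t P *t Q).
  by rewrite pkmx_local_copy /= subnn pktens1r -!pktensE pktensA.
have AE : pkmx (add_strand A) = pkmx (B *t (1%:M : 'M_d)).
  by rewrite pkmx_add_strand AB.
by rewrite (pkmx_trace (pkmx_mul AE LE)) tensmx_mul mxtrace_tens mul1mx Q0 mulr0.
Qed.

(** The two copies overlap only in the middle strand, where [Q] meets [P']. Hence they commute or
    anticommute as these two legs do. *)
Lemma local_copy3_mul (P Q P' Q' : 'M[C]_d) :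
  let L0 := @local_copy C d (P *t Q) 3 ord0 in
  let L1 := @local_copy C d (P' *t Q') 3 ord_max in
  pkmx (L1 *m L0) = pkmx (P *t (P' *m Q) *t Q') /\
  pkmx (L0 *m L1) = pkmx (P *t (Q *m P') *t Q').
Proof.
have E0 : pkmx (@local_copy C d (P *t Q) 3 ord0) =
    pkmx (P *t Q *t (1%:M : 'M_d)).
  by rewrite pkmx_local_copy pktens1l -[RHS]pktensE; congr pktens.
have E1 : pkmx (@local_copy C d (P' *t Q') 3 ord_max) =
    pkmx ((1%:M : 'M_d) *t P' *t Q').
  rewrite pkmx_local_copy pktens1r -!pktensE pktensA.
  by congr (pktens (pktens _ _) _).
by split; [rewrite (pkmx_mul E1 E0) | rewrite (pkmx_mul E0 E1)];
  rewrite !tensmx_mul !mulmx1 !mul1mx.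
Qed.

Lemma local_copy3_comm (P Q P' Q' : 'M[C]_d) : Q *m P' = P' *m Q ->
  let L0 := @local_copy C d (P *t Q) 3 ord0 in
  let L1 := @local_copy C d (P' *t Q') 3 ord_max in L1 * L0 = L0 * L1.
Proof.
move=> QP; have [E10 E01] := local_copy3_mul P Q P' Q'.
by apply: pkmx_inj; rewrite [LHS]E10 [RHS]E01 QP.
Qed.

Lemma local_copy3_anticomm (P Q P' Q' : 'M[C]_d) : Q *m P' = - (P' *m Q) ->
  let L0 := @local_copy C d (P *t Q) 3 ord0 in
  let L1 := @local_copy C d (P' *t Q') 3 ord_max in L1 * L0 = - (L0 * L1).
Proof.
move=> QP /=; have [E10 _] := local_copy3_mul P Q P' Q'.
(* The sign is carried by the first leg, so that the negated product is again of the form covered by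
   [local_copy3_mul]. *)
have [_ E01] := local_copy3_mul (- P) Q P' Q'.
have L_hom := @local_copy_hom 3 ord0.
have NPQ : - P *t (Q *m P') = P *t (P' *m Q).
  by rewrite QP tensNmx tensmxN opprK.
apply: pkmx_inj; rewrite [LHS]E10 -mulNr -(alg_homN L_hom) -tensNmx.
by rewrite [RHS]E01 NPQ.
Qed.

End LocalCopy.

(** * Localization of Hecke algebras modulo the radical *)

Lemma mxtrace_alg_homC (C : fieldType) (A : pzAlgType C) n (f : A -> 'M[C]_n) :
  alg_hom f -> forall x y, \tr (f (x * y)) = \tr (f (y * x)).
Proof. by move=> [_ fM _] x y; rewrite !fM -[LHS]/(\tr (_ *m _)) mxtrace_mulC. Qed.

(** * Positivity of the trace form, and images closed under adjoints *)

Section Adjoint.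
Local Open Scope sesquilinear_scope.

(** This trace is the sum of the squared moduli of all entries of [A]. *)
Lemma mxtrace_adj_eq0 (C : numClosedFieldType) m n (A : 'M[C]_(m, n)) :
  \tr (A *m A^t*) = 0 -> A = 0.
Proof.
have sq i k : A i k * (A^t*) k i = `|A i k| ^+ 2 by rewrite !mxE normCK.
move=> trA; apply/matrixP => i j; rewrite mxE.
have row_ge0 k : 0 <= (A *m A^t*) k k.
  by rewrite mxE sumr_ge0 // => l _; rewrite sq exprn_ge0.
have := psumr_eq0P (fun k _ => row_ge0 k) trA (i := i) isT.
rewrite mxE => /psumr_eq0P/(_ j isT); rewrite sq => A0.
by apply/eqP; rewrite -normr_eq0 -sqrf_eq0 A0 // => l _; rewrite sq exprn_ge0.
Qed.

Section AdjointClosure.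
Variables (C : numClosedFieldType) (A : pzAlgType C) (n : nat) (f : A -> 'M[C]_n).
Hypothesis f_hom : alg_hom f.

(** These elements form a subalgebra, so closure of the whole image under adjoints can be checked on
    generators. *)
Definition has_adj x := exists y, f y = (f x)^t*.

Lemma has_adj_scal c : has_adj (scal c).
Proof.
have [_ _ fk] := f_hom; exists (scal c^*).
by rewrite !fk -[scal c]/(c%:M) tr_scalar_mx map_scalar_mx.
Qed.

Lemma has_adjD x y : has_adj x -> has_adj y -> has_adj (x + y).
Proof.
have [fD _ _] := f_hom; move=> [x' xx'] [y' yy']; exists (x' + y').
by rewrite !fD xx' yy' linearD /= map_mxD.
Qed.

Lemma has_adjM x y : has_adj x -> has_adj y -> has_adj (x * y).
Proof.
have [_ fM _] := f_hom; move=> [x' xx'] [y' yy']; exists (y' * x').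
by rewrite !fM xx' yy' -[in RHS]/(_ *m _) trmx_mul map_mxM.
Qed.

(** The quadratic relation gives [x] the inverse $q^{-1}(x - (q - 1))$ within the algebra, and the
    inverse of a unitary matrix is its adjoint. *)
Lemma has_adj_unitary (q : C) x : q != 0 -> (x + 1) * (x - scal q) = 0 ->
  f x \is unitarymx -> has_adj x.
Proof.
move=> q0 quad /unitarymxP xx; have [_ fM _] := f_hom.
exists (scal q^-1 * (x - scal (q - 1))).
have x1 : (scal q^-1 * (x - scal (q - 1))) * x = 1.
  by rewrite -mulrA mulrBl (quad_sq quad) addrC addKr -scalM mulVf // scal1.
rewrite -[RHS]mul1mx -[1%:M](alg_hom1 f_hom) -x1 (fM _ x) -[X in X *m _]/(_ *m _).
by rewrite -mulmxA xx mulmx1.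
Qed.
End AdjointClosure.
End Adjoint.

Section Localization.
Variables (C : numClosedFieldType) (d : nat) (S : 'M[C]_(d * d)) (q eta : C).
Hypotheses (S_unitary : S \is unitarymx) (S_yb : yang_baxter S).
Hypothesis S_quad : (S + 1) * (S - scal q) = 0.
Hypotheses (q_neq0 : q != 0) (q1_neq0 : q + 1 != 0).
Hypothesis d_gt0 : (0 < d)%N.
(** The Markov property for unnormalized traces: the factor [d%:R] is the trace of the identity on
    the added strand. *)
Hypothesis S_markov : forall m (A : 'M[C]_(d ^ m.+1)),
  \tr (add_strand A *m @local_copy C d (spectral_proj q S) m.+2 ord_max) =
  eta * d%:R * \tr A.

Definition braid_mx n : hecke q n -> 'M[C]_(d ^ n) :=
  quot_lift (free_eval (fun i => local_copy S i)).

Lemma local_copy_quad n (i : 'I_n.-1) :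
  (local_copy S i + 1) * (local_copy S i - scal q) = 0.
Proof.
have L_hom := local_copy_hom C d i.
by rewrite -(alg_hom_quad L_hom) S_quad (alg_hom0 L_hom).
Qed.

Lemma braid_mx_hom n : alg_hom (@braid_mx n).
Proof.
apply: hecke_lift_hom => [i j|i j|i]; first exact: local_copy_braid.
  exact: local_copy_far.
exact: local_copy_quad.
Qed.

Lemma braid_mx_gen n (i : 'I_n.-1) : braid_mx (hecke_gen q i) = local_copy S i.
Proof.
apply: hecke_lift_gen => [{}i j|{}i j|{}i]; first exact: local_copy_braid.
  exact: local_copy_far.
exact: local_copy_quad.
Qed.

Lemma braid_mx_incl n (x : hecke q n) :
  braid_mx (hecke_incl x) = add_strand (braid_mx x).
Proof.
apply: (@hecke_hom_ext _ q n _ (fun x => braid_mx (hecke_incl x))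
  (fun x => add_strand (braid_mx x))) => [||i].
- exact: alg_hom_comp (hecke_incl_hom q n) (braid_mx_hom n.+1).
- exact: alg_hom_comp (braid_mx_hom n) (add_strand_hom C d n).
- by rewrite hecke_incl_gen !braid_mx_gen add_strand_local_copy.
Qed.

Lemma spectral_projE : spectral_proj q S = scal (q + 1)^-1 * (scal q - S).
Proof. by rewrite /spectral_proj addrC -mul_scalar_mx. Qed.

Lemma braid_mx_idem n (i : 'I_n.-1) :
  braid_mx (hecke_idem q i) = local_copy (spectral_proj q S) i.
Proof.
have [_ bM bk] := braid_mx_hom n; have [_ LM Lk] := local_copy_hom C d i.
rewrite spectral_projE bM bk (alg_homB (braid_mx_hom n)) bk braid_mx_gen.
by rewrite LM Lk (alg_homB (local_copy_hom C d i)) Lk.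
Qed.

Definition braid_trace n (x : hecke q n) : C :=
  \tr (braid_mx x) / (d ^ n)%:R.

Lemma braid_trace_markov : is_markov_trace eta braid_trace.
Proof.
have dn0 n : (d ^ n)%:R != 0 :> C by rewrite pnatr_eq0 -lt0n expn_gt0 d_gt0.
have d0 : d%:R != 0 :> C by rewrite pnatr_eq0 -lt0n.
split=> [n c x y|n x|n|n x y|m x]; rewrite /braid_trace.
- have [bD bM bk] := braid_mx_hom n.
  rewrite bD bM bk mxtraceD -[scal c * _]/(c%:M *m _) mul_scalar_mx mxtraceZ.
  by rewrite mulrDl mulrA.
- by rewrite braid_mx_incl mxtrace_add_strand expnSr natrM -mulf_div divff ?mulr1.
- by rewrite (alg_hom1 (braid_mx_hom n)) mxtrace1 divff.
- exact: (congr1 (fun t => t / (d ^ n)%:R)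
    (mxtrace_alg_homC (braid_mx_hom n) x y)).
- have [_ bM _] := braid_mx_hom m.+2.
  rewrite bM braid_mx_incl braid_mx_idem -[X in \tr X]/(_ *m _) S_markov.
  have -> : (d ^ m.+2)%:R = d%:R * (d ^ m.+1)%:R :> C by rewrite -natrM -expnS.
  by have := dn0 m.+1; move: (_%:R) (\tr _) => D t D0; field; rewrite d0 D0.
Qed.

Lemma braid_mx_adj n (x : hecke q n) : has_adj (@braid_mx n) x.
Proof.
have b_hom := braid_mx_hom n; elim/hecke_ind: x => [c|x y|c x|i x].
- exact: has_adj_scal.
- exact: has_adjD.
- exact/has_adjM/has_adj_scal.
- apply/has_adjM/(has_adj_unitary b_hom q_neq0 (hecke_quadE q i)) => //.
  rewrite braid_mx_gen; apply/unitarymxP; rewrite adjmx_local_copy.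
  have [_ LM _] := local_copy_hom C d i.
  rewrite -[LHS]LM -[_ * _]/(_ *m _) (unitarymxP S_unitary).
  exact: alg_hom1 (local_copy_hom C d i).
Qed.

Lemma markov_radicalP n (x : hecke q n) :
  markov_radical eta x <-> braid_mx x = 0.
Proof.
have dn0 : (d ^ n)%:R != 0 :> C by rewrite pnatr_eq0 -lt0n expn_gt0 d_gt0.
have [_ bM _] := braid_mx_hom n.
have trE := markov_traceE q1_neq0 braid_trace_markov.
split=> [rx|x0 y]; last by rewrite trE /braid_trace bM x0 mul0r linear0 mul0r.
(* The radical condition is tested against a [y] whose image is the adjoint of the image of [x]. *)
have [y yx] := braid_mx_adj x; have := rx y.
rewrite trE /braid_trace bM yx => /eqP.
rewrite mulf_eq0 invr_eq0 (negPf dn0) orbF => /eqP.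
exact: mxtrace_adj_eq0.
Qed.

Lemma hecke_strict_localization :
  strict_localization (fun n => @hecke_mod_radical_gen C q eta n) S.
Proof.
split=> // n.
have b_hom := braid_mx_hom n.
have rad0 (x : hecke q n) : markov_radical eta x -> braid_mx x = 0.
  by move/markov_radicalP.
exists (quot_lift (@braid_mx n)); split.
- exact: (quot_lift_hom b_hom rad0).
- by move=> i; rewrite (quot_lift_pi b_hom rad0) braid_mx_gen.
- move=> u v; elim/qpi_ind: u => x; elim/qpi_ind: v => y.
  rewrite !(quot_lift_pi b_hom rad0) => xy; apply/qpiP; apply: gen_ideal_sub.
  by apply/markov_radicalP; rewrite (alg_homB b_hom) xy subrr.
Qed.

(* The normalized trace of e_1 e_2 e_1 is eta ^+ 2, that of e_1 is eta. *)
Lemma not_temperley_lieb : eta != 0 -> eta != q / (1 + q) ^+ 2 ->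
  ~ is_temperley_lieb q S.
Proof.
move=> eta0 etaq tl.
have b_hom := braid_mx_hom.
have [_ trI tr1 trC trE] := braid_trace_markov.
have trM := braid_trace_markov.
(* Three strands, the first case with a Temperley-Lieb relation, already give the contradiction. *)
have [tau tau_hom tauE] : factors_through_TL (@braid_mx 3).
  by apply: tl; split=> // i; exact: braid_mx_gen.
pose e : hecke q 2 := @hecke_idem C q 2 ord_max.
pose e1 := hecke_incl e; pose e2 := @hecke_idem C q 3 ord_max.
have ee : e * e = e by exact: idem_of_quad q1_neq0 (hecke_quadE q _).
have tre : braid_trace e = eta.
  have := trE 0%N 1; rewrite (alg_hom1 (hecke_incl_hom q 1)) mul1r tr1 mulr1.
  exact.
have e1E : e1 = @hecke_idem C q 3 ord0.
  have [_ iM ik] := hecke_incl_hom q 2.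
  rewrite /e1 /e /hecke_idem iM ik (alg_homB (hecke_incl_hom q 2)) ik.
  by rewrite hecke_incl_gen; congr (_ * (_ - hecke_gen _ _)); apply: val_inj.
(* Cyclicity and idempotency leave the trace of [e1 * e2], to which the Markov property applies;
   [tre] evaluates the remaining factor. *)
have tre12 : braid_trace (e1 * e2 * e1) = eta * eta.
  have [_ iM _] := hecke_incl_hom q 2.
  by rewrite trC mulrA -iM ee trE tre.
pose t := q / (1 + q) ^+ 2.
have relE : braid_mx (e1 * e2 * e1 - scal t * e1) = 0.
  rewrite tauE -(alg_hom0 tau_hom); congr tau; apply/qpiP; rewrite subr0.
  by apply: gen_ideal_sub; rewrite e1E; exact: temperley_lieb_rel.
have : braid_trace (e1 * e2 * e1) = t * eta.
  have /eqP := relE; rewrite (alg_homB (b_hom 3)) subr_eq0 => /eqP te.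
  rewrite -tre -(trI 2) -(markov_traceZ trM).
  exact: (congr1 (fun M : 'M[C]_(d ^ 3) => \tr M / (d ^ 3)%:R) te).
by rewrite tre12 => /(mulIf eta0)/eqP; apply/negP.
Qed.

End Localization.

(** * Membership in a Hecke class from the trace of the spectral projection *)

Lemma mxtrace_idem (K : fieldType) n (p : 'M[K]_n) :
  p *m p = p -> \tr p = (\rank p)%:R.
Proof.
(* In the rank factorization of [p], idempotency lets both full-rank factors be cancelled, so the
   reversed product is the identity of size [\rank p]. *)
move=> pp; have : row_base p *m col_base p = 1%:M.
  apply: (row_free_inj (row_base_free p)); apply: (row_full_inj (col_base_full p)).
  by rewrite mul1mx -mulmxA mulmx_base mulmxA mulmx_base.
by move=> rc; rewrite -[in LHS](mulmx_base p) mxtrace_mulC rc mxtrace1.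
Qed.

Lemma eigenvalue_mul (K : fieldType) n (p S : 'M[K]_n) a :
  p != 0 -> p *m S = a *: p -> eigenvalue S a.
Proof.
case/rowV0Pn=> v /submxP[w ->] v0 pS.
by apply/eigenvalueP; exists (w *m p); rewrite // -mulmxA pS scalemxAr.
Qed.

Section HeckeClass.
Variables (C : numClosedFieldType) (d : nat) (S : 'M[C]_(d * d)) (q : C).
Hypotheses (S_unitary : S \is unitarymx) (S_yb : yang_baxter S).
Hypothesis S_quad : (S + 1) * (S - scal q) = 0.
Hypotheses (q1_neq0 : q + 1 != 0) (q_neq1 : q != 1).
Local Notation p := (spectral_proj q S).

(** [p] is idempotent, so its trace is its rank. The bounds on [r] make [p] and [1 - p] nonzero;
    their row spaces consist of eigenvectors for [- 1] and [q], and the quadratic relation excludes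
    other eigenvalues. *)
Lemma hecke_class_mxtrace r : (0 < r < d * d)%N -> \tr p = r%:R ->
  hecke_class q (r%:R / (d ^ 2)%:R) S.
Proof.
move=> /andP[r0 rd] trp.
have pE : p = scal (q + 1)^-1 * (scal q - S) by exact: spectral_projE.
have pp : p *m p = p by rewrite pE; exact: idem_of_quad.
have rp : \rank p = r.
  by apply/eqP; rewrite -(eqr_nat C) -trp mxtrace_idem.
have p0 : p != 0 by rewrite -mxrank_eq0 rp -lt0n.
have p1 : 1 - p != 0.
  rewrite subr_eq0; apply/eqP => p1; move: rd.
  by rewrite -rp -p1 mxrank1 ltnn.
have SE : S = scal q - scal (q + 1) * p.
  by rewrite pE mulrA -scalM divff // scal1 mul1r opprB addrC subrK.
have S_eig a : eigenvalue S a = (a == - 1) || (a == q).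
  apply/idP/orP => [/eigenvalueP[v vS v0]|[]/eqP->].
  - have : v *m ((S + 1) * (S - scal q)) = ((a + 1) * (a - q)) *: v.
      have vS1 : v *m (S + 1) = (a + 1) *: v.
        by rewrite mulmxDr vS mulmx1 scalerDl scale1r.
      rewrite (mulmxA v (S + 1) (S - scal q)) vS1 -scalemxAl mulmxBr vS.
      by rewrite mul_mx_scalar -scalerBl scalerA.
    rewrite S_quad mulmx0 => /esym/eqP; rewrite scaler_eq0 (negPf v0) orbF.
    rewrite mulf_eq0 addr_eq0 subr_eq0 => /orP[]->; by [left | right].
  - apply: (eigenvalue_mul p0); rewrite {2}SE mulmxBr mul_mx_scalar.
    rewrite -[scal _ * p]/(scal (q + 1) *m p) mul_scalar_mx -scalemxAr pp.
    by rewrite -scalerBl; congr (_ *: _); ring.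
  - apply: (eigenvalue_mul p1); rewrite {2}SE mulmxBr mul_mx_scalar.
    rewrite -[scal _ * p]/(scal (q + 1) *m p) mul_scalar_mx -scalemxAr.
    by rewrite mulmxBl mul1mx pp subrr scaler0 subr0.
have qN1 : q != - 1 by rewrite -addr_eq0.
by split; [split | rewrite /spectral_density rp].
Qed.

End HeckeClass.

(** * Operators built from quaternion units *)

(* Composing with an arbitrary additive map to a commutative ring lets [ring]
   collect the noncommutative monomials. *)
Lemma quaternion_braid (A : pzRingType) (K : comPzRingType) (f : A -> K)
    (a b c d : A) : {morph f : x y / x + y} ->
  a * a = - 1 -> b * b = - 1 -> c * c = - 1 -> d * d = - 1 ->
  b * a = - (a * b) -> d * c = - (c * d) ->
  c * a = a * c -> d * b = b * d -> d * a = - (a * d) -> c * b = - (b * c) ->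
  let u := 1 + a + b + a * b in let v := 1 + c + d + c * d in
  f (u * v * u) = f (v * u * v).
Proof.
move=> fD aa bb cc dd ba dc ca db da cb.
have f0 : f 0 = 0 by apply: (addIr (f 0)); rewrite -fD !add0r.
have fN x : f (- x) = - f x by apply: (addIr (f x)); rewrite -fD !addNr f0.
have R x y z : y * z = - (z * y) -> x * y * z = - (x * z * y) :> A.
  by move=> yz; rewrite -mulrA yz mulrN mulrA.
have R' x y z : y * z = z * y -> x * y * z = x * z * y :> A.
  by move=> yz; rewrite -mulrA yz mulrA.
have R2 x y : y * y = -1 -> x * y * y = - x :> A.
  by move=> yy; rewrite -mulrA yy mulrN mulr1.
(* The same relations behind an arbitrary prefix, as needed inside left-associated words. Rewriting
   sorts every word into the order [a], [b], [c], [d]. *)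
pose E := (fun x => R2 x _ aa, fun x => R2 x _ bb,
  fun x => R2 x _ cc, fun x => R2 x _ dd,
  fun x => R x _ _ ba, fun x => R x _ _ dc, fun x => R' x _ _ ca,
  fun x => R' x _ _ db, fun x => R x _ _ da, fun x => R x _ _ cb).
rewrite /= !(mulrDl, mulrDr, mulr1, mul1r, mulrA).
rewrite !(aa, bb, cc, dd, ba, dc, ca, db, da, cb, E, mulrN, mulNr, opprK,
  mul1r, mulr1).
by rewrite !(fD, fN); ring.
Qed.

Lemma scal_mxE (K : fieldType) n (k : K) : scal k = k%:M :> 'M_n.
Proof. by []. Qed.

Lemma scal_mulE (K : fieldType) n (k : K) (A : 'M_n) : scal k * A = k *: A.
Proof. exact: mul_scalar_mx. Qed.

Section QuaternionOperator.
Local Open Scope sesquilinear_scope.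
Variables (C : numClosedFieldType) (d : nat) (P1 Q1 P2 Q2 : 'M[C]_d).
Let U := P1 *t Q1.
Let V := P2 *t Q2.
Variables (c h : C).
Let S := scal c * (1 + U + V + U * V).
Hypotheses (UU : U * U = - 1) (VV : V * V = - 1).
Hypotheses (VU : V * U = - (U * V)) (ch : 2 * c = h - 1) (hh : h * h = h - 1).
Hypotheses (Q1P1 : Q1 *m P1 = P1 *m Q1) (Q2P2 : Q2 *m P2 = P2 *m Q2).
Hypotheses (Q1P2 : Q1 *m P2 = - (P2 *m Q1)) (Q2P1 : Q2 *m P1 = - (P1 *m Q2)).
Hypotheses (trQ1 : \tr Q1 = 0) (trQ2 : \tr Q2 = 0) (trQ12 : \tr (Q1 *m Q2) = 0).
Hypotheses (U_adj : U^t* = - U) (V_adj : V^t* = - V) (cc : c * c^* = 4^-1).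

(** [U], [V] and [U * V] anticommute pairwise, so only their three squares survive, each equal to
    [- 1]. *)
Lemma quaternion_sq : let N := U + V + U * V in N * N = - 3%:R.
Proof.
have UVU : U * V * U = V by rewrite -mulrA VU mulrN mulrA UU mulN1r opprK.
have UVV : U * V * V = - U by rewrite -mulrA VV mulrN1.
have UUV : U * (U * V) = - V by rewrite mulrA UU mulN1r.
have VUV : V * (U * V) = U by rewrite mulrA VU mulNr UVV opprK.
have UVUV : U * V * (U * V) = - 1 by rewrite -mulrA VUV UU.
rewrite /= !mulrDl !mulrDr UU VV VU UVU UVV UUV VUV UVUV.
by apply/matrixP => i j; rewrite !mxE; ring.
Qed.

Lemma quaternion_operator_yb : yang_baxter S.
Proof.
rewrite /yang_baxter /S.
set f0 := fun A => @local_copy C d A 3 ord0.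
set f1 := fun A => @local_copy C d A 3 ord_max.
have f0_hom : alg_hom f0 := local_copy_hom C d (n := 3) ord0.
have f1_hom : alg_hom f1 := local_copy_hom C d (n := 3) ord_max.
have [f0D f0M f0k] := f0_hom; have [f1D f1M f1k] := f1_hom.
have f0S : f0 S = scal c * (1 + f0 U + f0 V + f0 U * f0 V).
  by rewrite f0M f0k !f0D (alg_hom1 f0_hom) f0M.
have f1S : f1 S = scal c * (1 + f1 U + f1 V + f1 U * f1 V).
  by rewrite f1M f1k !f1D (alg_hom1 f1_hom) f1M.
suff uvu : f0 S * f1 S * f0 S = f1 S * f0 S * f1 S by exact: uvu.
(* Both sides carry the same power of [c]; each matrix entry then serves as the additive map in
   [quaternion_braid]. *)
rewrite f0S f1S !scalMM; congr (_ * _); apply/matrixP => i j.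
apply: (@quaternion_braid _ _ (fun M : 'M[C]_(d ^ 3) => M i j)).
- by move=> x y; rewrite mxE.
- by rewrite -f0M UU (alg_homN f0_hom) (alg_hom1 f0_hom).
- by rewrite -f0M VV (alg_homN f0_hom) (alg_hom1 f0_hom).
- by rewrite -f1M UU (alg_homN f1_hom) (alg_hom1 f1_hom).
- by rewrite -f1M VV (alg_homN f1_hom) (alg_hom1 f1_hom).
- by rewrite -!f0M VU (alg_homN f0_hom).
- by rewrite -!f1M VU (alg_homN f1_hom).
- exact: local_copy3_comm.
- exact: local_copy3_comm.
- exact: local_copy3_anticomm.
- exact: local_copy3_anticomm.
Qed.

Let N := U + V + U * V.

Lemma quaternion_operatorE : S = c *: (1 + N).
Proof. by rewrite /S /N scal_mulE !addrA. Qed.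

(** From $(1+N)^2 = 2(1+N) - 4$ one gets $S^2 = 2cS - 4c^2$, where $2c = h - 1$ and $4c^2 = (h-1)^2
    = -h$. *)
Lemma quaternion_operator_quad : (S + 1) * (S - scal h) = 0.
Proof.
have NN : N * N = - 3%:R := quaternion_sq.
have : (1 + N) * (1 + N) = 2 *: (1 + N) - 4 *: 1%:M.
  rewrite mulrDl mul1r mulrDr mulr1 NN.
  by apply/matrixP => i j; rewrite !mxE; ring.
rewrite quaternion_operatorE scal_mxE -(scalemx1 _ h); move: (1 + N) => X XX.
have cch : 4 * (c * c) = - h.
  rewrite (_ : 4 * (c * c) = (2 * c) * (2 * c)); last by ring.
  by rewrite ch mulrBl mul1r mulrBr hh mulr1; ring.
rewrite -[LHS]/((c *: X + 1%:M) *m (c *: X - h *: 1%:M)).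
rewrite mulmxDl mul1mx mulmxBr -!scalemxAl -!scalemxAr mulmx1 -[X *m X]/(X * X) XX.
apply/matrixP => i j; rewrite !mxE; move: (X i j) ((i == j)%:R) => x e.
apply: etrans (_ : (c * x) * (2 * c - (h - 1)) - e * (4 * (c * c) + h) = 0).
  by ring.
by rewrite ch cch addNr subrr !mulr0 subrr.
Qed.

(** [N] is skew-adjoint, so $(1+N)(1-N) = 1 - N^2 = 4$, which is cancelled by $|c|^2 = 1/4$. *)
Lemma quaternion_operator_unitary : S \is unitarymx.
Proof.
have NN : N * N = - 3%:R := quaternion_sq.
have N_adj : N^t* = - N.
  rewrite /N !linearD /= !map_mxD U_adj V_adj; congr (_ + _).
  rewrite -[U * V]/(U *m V) trmx_mul map_mxM U_adj V_adj.
  by rewrite -[LHS]/(_ * _) mulrNN VU.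
have N1_adj : (1%:M + N)^t* = 1%:M - N.
  by rewrite linearD /= trmx1 map_mxD map_mx1 N_adj.
apply/unitarymxP; rewrite quaternion_operatorE linearZ /= map_mxZ N1_adj.
rewrite -scalemxAl -scalemxAr scalerA cc.
have -> : (1 + N) *m (1%:M - N) = 4%:R *: 1%:M.
  rewrite -[LHS]/((1 + N) * (1 - N)) mulrBr mulr1 mulrDl mul1r NN.
  by apply/matrixP => i j; rewrite !mxE; ring.
by rewrite scalerA mulVf ?scale1r // pnatr_eq0.
Qed.

(** The relation $h^2 = h - 1$ gives $(1+h)^2 = 3h$, whence the Temperley-Lieb parameter $1/3$. *)
Lemma hecke_param_neq : [/\ h != 0, h != 1, h + 1 != 0 & h / (1 + h) ^+ 2 = 3^-1].
Proof.
have h3 : (1 + h) ^+ 2 = 3 * h by rewrite expr2 mulrDl !mulrDr hh; ring.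
have h0 : h != 0.
  apply/eqP => h0; have /eqP := hh.
  by rewrite h0 mulr0 sub0r eq_sym oppr_eq0 oner_eq0.
split=> //.
- apply/eqP => h1; have /eqP := hh.
  by rewrite h1 mulr1 subrr oner_eq0.
- by rewrite addrC -sqrf_eq0 h3 mulf_neq0 // pnatr_eq0.
- by rewrite h3; field.
Qed.

(** Such a functional sees only the scalar part $(h - c)/(1 + h)$ of the projection, which is $1/2$
    because $h = 2c + 1$. It serves both the Markov property and the plain trace. *)
Lemma quaternion_functional (g : 'M[C]_(d * d) -> C) :
  {morph g : A B / A + B} -> (forall k A, g (k *: A) = k * g A) ->
  g U = 0 -> g V = 0 -> g (U * V) = 0 ->
  g (spectral_proj h S) = 2^-1 * g 1%:M.
Proof.
move=> gD gZ gU gV gUV; have [_ _ h1 _] := hecke_param_neq.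
rewrite /spectral_proj quaternion_operatorE -(scalemx1 _ h) -scaleN1r.
have hc : h = 2 * c + 1 by rewrite ch subrK.
rewrite gZ gD !gZ !gD gU gV gUV !addr0 hc -[g 1]/(g 1%:M); field.
by move: h1; rewrite hc; apply: contraNneq => H; rewrite -H; apply/eqP; ring.
Qed.

Lemma quaternion_operator_markov m (A : 'M[C]_(d ^ m.+1)) :
  \tr (add_strand A *m @local_copy C d (spectral_proj h S) m.+2 ord_max) =
  2^-1 * d%:R * \tr A.
Proof.
have L_hom := local_copy_hom C d (n := m.+2) ord_max; have [LD LM Lk] := L_hom.
pose g B := \tr (add_strand A *m @local_copy C d B m.+2 ord_max).
rewrite -[LHS]/(g _) quaternion_functional /g.
- rewrite [local_copy 1%:M _](alg_hom1 L_hom) mulmx1 mxtrace_add_strand.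
  by rewrite -mulrA [_ * d%:R]mulrC.
- by move=> B B'; rewrite LD mulmxDr mxtraceD.
- by move=> k B; rewrite -scal_mulE LM Lk scal_mulE -scalemxAr mxtraceZ.
- exact: mxtrace_add_strand_local_copy.
- exact: mxtrace_add_strand_local_copy.
- rewrite -[U * V]/(U *m V) /U /V tensmx_mul.
  exact: mxtrace_add_strand_local_copy.
Qed.

Lemma quaternion_operator_mxtrace :
  \tr (spectral_proj h S) = 2^-1 * (d * d)%:R.
Proof.
rewrite (quaternion_functional (g := @mxtrace C _)) ?mxtrace1 //.
- by move=> A B; rewrite mxtraceD.
- by move=> k A; rewrite mxtraceZ.
- by rewrite mxtrace_tens trQ1 mulr0.
- by rewrite mxtrace_tens trQ2 mulr0.
- by rewrite -[U * V]/(U *m V) /U /V tensmx_mul mxtrace_tens trQ12 mulr0.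
Qed.

End QuaternionOperator.

(** * The operator R *)

Section OperatorR.
Local Open Scope sesquilinear_scope.
Variable R : realType.
Local Notation C := R[i].
Local Notation X := (@opX R).
Local Notation Z := (@opZ R).

Lemma opX_sq : X *m X = 1%:M.
Proof.
apply/matrixP => i j; rewrite !mxE !big_ord_recl !big_ord0 !mxE.
by case: i j => [[|[|//]] ?] [[|[|//]] ?]; rewrite /= ?mxE /bump /=; ring.
Qed.

Lemma opZ_sq : Z *m Z = 1%:M.
Proof.
apply/matrixP => i j; rewrite !mxE !big_ord_recl !big_ord0 !mxE.
by case: i j => [[|[|//]] ?] [[|[|//]] ?]; rewrite /= ?mxE /bump /=; ring.
Qed.

Lemma opZX : Z *m X = - (X *m Z).
Proof.
apply/matrixP => i j; rewrite !mxE !big_ord_recl !big_ord0 !mxE.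
by case: i j => [[|[|//]] ?] [[|[|//]] ?]; rewrite /= ?mxE /bump /=; ring.
Qed.

Lemma mxtrace_opX : \tr X = 0.
Proof. by rewrite /mxtrace !big_ord_recl !big_ord0 !mxE /= !addr0. Qed.

Lemma mxtrace_opZ : \tr Z = 0.
Proof.
by rewrite /mxtrace !big_ord_recl !big_ord0 !mxE /= /bump /=; ring.
Qed.

Lemma opX_adj : X^t* = X.
Proof.
apply/matrixP => i j; rewrite !mxE.
by case: i j => [[|[|//]] ?] [[|[|//]] ?]; rewrite /= ?rmorph0 ?rmorph1.
Qed.

Lemma opZ_adj : Z^t* = Z.
Proof.
apply/matrixP => i j; rewrite !mxE.
by case: i j => [[|[|//]] ?] [[|[|//]] ?];
  rewrite /= ?mulr0 ?mulr1 ?rmorph0 ?rmorph1 ?rmorphN1.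
Qed.

Lemma iC_sq : iC * iC = - 1 :> C.
Proof.
apply/eqP; rewrite eq_complex /=.
by rewrite !(mul0r, mulr0, mul1r, sub0r, addr0, oppr0, eqxx).
Qed.

Lemma iC_conj : (iC : C)^* = - iC.
Proof. by apply/eqP; rewrite eq_complex /= oppr0 !eqxx. Qed.

(** The triple-angle formula at [pi / 6] reads $3s - 4s^3 = 1$, that is $(2s-1)^2(s+1) = 0$, and $s
    > 0$. *)
Lemma sin_pi6 : sin (pi / 6 : R) = 2^-1.
Proof.
set x := pi / 6; set s := sin x.
have x3 : x + x + x = pi / 2 by rewrite /x; field.
have pi0 := pi_gt0 R.
have s0 : 0 < s.
  apply: sin_gt0_pihalf; apply/andP; split; rewrite /x.
    by rewrite divr_gt0.
  by rewrite ltr_pM2l // ltf_pV2 ?posrE // ltr_nat.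
have : (2 * s - 1) ^+ 2 * (s + 1) = 0.
  have := sin_pihalf R; rewrite -x3 !(sinD, cosD) -/s => s3.
  have := cos2Dsin2 x; rewrite -/s => c2.
  have c2E : cos x * cos x = 1 - s * s by rewrite -c2 expr2; ring.
  have s3E : 3 * s - 4 * (s * s * s) = 1.
    apply: etrans s3; transitivity (3 * s * (cos x * cos x) - s * s * s).
      by rewrite c2E; ring.
    by ring.
  apply: etrans (_ : 1 - (3 * s - 4 * (s * s * s)) = 0); first by ring.
  by rewrite s3E subrr.
move/eqP; rewrite mulf_eq0 orbC gt_eqF ?addr_gt0 //= expf_eq0 /= subr_eq0.
move/eqP => s1; apply: (mulfI (x := 2)); rewrite ?pnatr_eq0 //.
by rewrite s1 divff ?pnatr_eq0.
Qed.

(** The factor [iC] is put into the first legs; the second legs [QU], [QV] are self-adjoint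
    involutions of trace zero. *)
Let PU : 'M[C]_(2 * 2) := iC *: (1%:M *t Z).
Let QU : 'M[C]_(2 * 2) := Z *t 1%:M.
Let PV : 'M[C]_(2 * 2) := iC *: (X *t 1%:M).
Let QV : 'M[C]_(2 * 2) := X *t X.

Lemma opUE : opU = PU *t QU. Proof. exact: scale_tensmx. Qed.
Lemma opVE : opV = PV *t QV. Proof. exact: scale_tensmx. Qed.

Lemma op_sq (P Q : 'M[C]_(2 * 2)) : P *m P = 1%:M -> Q *m Q = 1%:M ->
  ((iC *: P) *t Q) *m ((iC *: P) *t Q) = - 1%:M.
Proof.
move=> PP QQ; rewrite tensmx_mul -scalemxAl -scalemxAr scalerA iC_sq PP QQ.
by rewrite scaleN1r tensNmx tensmx_id.
Qed.

Lemma opU_sq : (PU *t QU) *m (PU *t QU) = - 1%:M.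
Proof. by apply: op_sq; rewrite tensmx_mul opZ_sq mulmx1 tensmx_id. Qed.

Lemma opV_sq : (PV *t QV) *m (PV *t QV) = - 1%:M.
Proof. by apply: op_sq; rewrite tensmx_mul opX_sq ?mulmx1 tensmx_id. Qed.

Lemma PV_PU : PV *m PU = PU *m PV.
Proof.
by rewrite /PU /PV -!scalemxAl -!scalemxAr !tensmx_mul !mulmx1 !mul1mx.
Qed.

Lemma opVU : (PV *t QV) *m (PU *t QU) = - ((PU *t QU) *m (PV *t QV)).
Proof.
by rewrite !tensmx_mul PV_PU mul1mx mulmx1 opZX tensNmx tensmxN opprK.
Qed.

Lemma op_adj (P Q : 'M[C]_(2 * 2)) : P^t* = P -> Q^t* = Q ->
  ((iC *: P) *t Q)^t* = - ((iC *: P) *t Q).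
Proof.
move=> PP QQ; rewrite adjmx_tens linearZ /= map_mxZ /= iC_conj PP QQ.
by rewrite scaleNr tensNmx.
Qed.

Lemma opU_adj : (PU *t QU)^t* = - (PU *t QU).
Proof. by apply: op_adj; rewrite adjmx_tens opZ_adj trmx1 map_mx1. Qed.

Lemma opV_adj : (PV *t QV)^t* = - (PV *t QV).
Proof. by apply: op_adj; rewrite adjmx_tens opX_adj ?trmx1 ?map_mx1. Qed.

Lemma QU_PU : QU *m PU = PU *m QU.
Proof. by rewrite -scalemxAl -scalemxAr !tensmx_mul !mulmx1 !mul1mx. Qed.

Lemma QV_PV : QV *m PV = PV *m QV.
Proof. by rewrite -scalemxAl -scalemxAr !tensmx_mul !mulmx1 !mul1mx. Qed.

(** Here, as for [QV] and [PU] below, [Z] and [X] meet in exactly one tensor slot, which yields one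
    sign. *)
Lemma QU_PV : QU *m PV = - (PV *m QU).
Proof.
by rewrite -scalemxAl -scalemxAr !tensmx_mul !mulmx1 opZX tensNmx scalerN.
Qed.

Lemma QV_PU : QV *m PU = - (PU *m QV).
Proof.
by rewrite -scalemxAl -scalemxAr !tensmx_mul mulmx1 mul1mx opZX tensmxN
  scalerN opprK.
Qed.

Lemma mxtrace_QU : \tr QU = 0.
Proof. by rewrite mxtrace_tens mxtrace_opZ mul0r. Qed.

Lemma mxtrace_QV : \tr QV = 0.
Proof. by rewrite mxtrace_tens mxtrace_opX mul0r. Qed.

Lemma mxtrace_QUV : \tr (QU *m QV) = 0.
Proof. by rewrite tensmx_mul mul1mx mxtrace_tens mxtrace_opX mulr0. Qed.

(** * The coefficient of $R$ and the Hecke parameter in coordinates *)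

Let x : R := pi / 6.
Let zeta : C := expi x.
Let c : C := iC * zeta / 2.
Let h : C := expi (pi / 3).

Let k : R := cos x.

Lemma cos_pi6_sq : k * k = 3 / 4.
Proof.
have := cos2Dsin2 x; rewrite sin_pi6 -/k => k2.
by apply: (addIr (2^-1 ^+ 2)); rewrite -expr2 k2; field.
Qed.

Lemma expi_pi3E : h = (2^-1 +i* k)%C.
Proof.
have -> : h = expi (x + x) by congr expi; rewrite /x; field.
rewrite /expi cosD sinD -/k sin_pi6 cos_pi6_sq.
by congr (_ +i* _)%C; field.
Qed.

Lemma izetaE : iC * zeta = (- 2^-1 +i* k)%C.
Proof.
apply/eqP; rewrite /zeta /expi sin_pi6 eq_complex /=.
by rewrite !(mul0r, mul1r, sub0r, add0r, eqxx).
Qed.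

(** [2 * c] is [iC * zeta], the cube root of unity $e^{2\pi\mathrm i/3}$, with the same imaginary
    part as [h] and real part smaller by 1. *)
Lemma coefRE : 2 * c = h - 1.
Proof.
rewrite /c mulrC divfK ?pnatr_eq0 // izetaE expi_pi3E.
by apply/eqP; rewrite eq_complex /= subr0 eqxx andbT; apply/eqP; field.
Qed.

Lemma expi_pi3_sq : h * h = h - 1.
Proof.
rewrite expi_pi3E; apply/eqP; rewrite eq_complex /= cos_pi6_sq subr0; apply/andP.
by split; apply/eqP; field.
Qed.

Lemma coefR_norm : c * c^* = 4^-1.
Proof.
have zz : (iC * zeta) * (iC * zeta)^* = 1.
  rewrite izetaE; apply/eqP; rewrite eq_complex /=; apply/andP.
  by split; apply/eqP; rewrite ?mulrN ?opprK ?cos_pi6_sq; field.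
rewrite /c rmorphM fmorphV rmorph_nat mulrACA zz.
by field.
Qed.

End OperatorR.

Local Open Scope complex_scope.

Theorem theorem13p3 (R : realType) :
  let zeta : R[i] := expi (pi / 6) in
  let Rop : 'M[R[i]]_(4 * 4) :=
    (iC * zeta / 2) *: (1%:M + opU + opV + opU *m opV) in
  [/\ hecke_class (d := 4) (expi (pi / 3)) (1 / 2) Rop,
      ~ is_temperley_lieb (d := 4) (expi (pi / 3)) Rop &
      strict_localization (d := 4) (@H36_gen R) Rop].
Proof.
move=> zeta Rop.
pose c : R[i] := iC * zeta / 2.
pose PU : 'M[R[i]]_4 := iC *: ((1%:M : 'M_2) *t opZ).
pose QU : 'M[R[i]]_4 := opZ *t (1%:M : 'M_2).
pose PV : 'M[R[i]]_4 := iC *: (opX *t (1%:M : 'M_2)).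
pose QV : 'M[R[i]]_4 := opX *t opX.
pose S : 'M[R[i]]_(4 * 4) :=
  scal c * (1 + PU *t QU + PV *t QV + (PU *t QU) * (PV *t QV)).
have RS : Rop = S by rewrite /S scal_mulE -[PU *t QU]opUE -[PV *t QV]opVE.
have S_yb : yang_baxter S.
  by apply: quaternion_operator_yb;
    [exact: opU_sq | exact: opV_sq | exact: opVU | exact: QU_PU
    | exact: QV_PV | exact: QU_PV | exact: QV_PU].
have S_quad := quaternion_operator_quad (opU_sq R) (opV_sq R) (opVU R)
  (coefRE R) (expi_pi3_sq R).
pose h : R[i] := expi (pi / 3).
have [h0 h1 h1n h3] := hecke_param_neq (expi_pi3_sq R).
have S_unitary := quaternion_operator_unitary (opU_sq R) (opV_sq R) (opVU R)
  (opU_adj R) (opV_adj R) (coefR_norm R).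
have S_markov := quaternion_operator_markov PU PV (coefRE R) (expi_pi3_sq R)
  (mxtrace_QU R) (mxtrace_QV R) (mxtrace_QUV R).
have S_trace := quaternion_operator_mxtrace PU PV (coefRE R) (expi_pi3_sq R)
  (mxtrace_QU R) (mxtrace_QV R) (mxtrace_QUV R).
rewrite RS; split.
(* The spectral projection has rank 8, half of the dimension 16. *)
- have -> : 1 / 2 = 8%:R / (4 ^ 2)%:R :> rat by [].
  apply: (hecke_class_mxtrace S_unitary S_yb S_quad h1n h1) => //.
  rewrite [LHS]S_trace; apply: (mulfI (x := 2)); first by rewrite pnatr_eq0.
  by rewrite mulrA divff ?pnatr_eq0 // mul1r -natrM.
- apply: (not_temperley_lieb S_yb S_quad h1n _ S_markov) => //.
    by rewrite invr_eq0 pnatr_eq0.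
  (* The Markov parameter is $1/2$, the Temperley-Lieb parameter $1/3$. *)
  by rewrite h3 (inj_eq invr_inj) eqr_nat.
- have := hecke_strict_localization S_unitary S_yb S_quad h0 h1n isT S_markov.
  rewrite /H36_gen /H36.
  have -> : expi (2 * pi / 6) = h by congr expi; field.
  by rewrite div1r.
Qed.
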